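(* Let $G$ be an abelian group. The second shuffles form a coideal in the Lie coalgebra $\widetilde{\mathcal D}(G)$; that is, if $J\subset\widetilde{\mathcal D}(G)$ denotes the subspace spanned by the images of all second shuffles, then $\delta(J)$ is contained in the image of $J\otimes\widetilde{\mathcal D}(G)$ in $\bigwedge^2\widetilde{\mathcal D}(G)$. Consequently the coproduct on $\widetilde{\mathcal D}(G)$ descends to a well-defined coproduct on $\mathcal D(G)=\widetilde{\mathcal D}(G)/J$.
   Context: **Cyclic Lie coalgebra.** $G$ is written multiplicatively, and a formal element $0$ with $0\cdot g=0$ is adjoined. Let $V$ be the $\mathbb{Q}$-vector space with basis $G\cup\{0\}$. $\mathcal C(G)$ is the quotient of the tensor algebra $T(V)$ by cyclic symmetry; it is graded by weight, the weight $n$ part ($n\ge1$) being generated by $C(x_0,\dots,x_n)=x_0\otimes\dots\otimes x_n$, $x_i\in G\cup\{0\}$, modulo $C(x_0,\dots,x_n)=C(x_1,\dots,x_n,x_0)$. Its coproduct is $$\delta C(x_0,\dots,x_n)=\sum_{\rm cyc}\sum_{i=1}^{n-1}C(x_0,x_1,\dots,x_i)\wedge C(x_0,x_{i+1},\dots,x_n),$$ the outer sum being over cyclic permutations of the indices $0,\dots,n$. **$\widetilde{\mathcal D}(G)$** is the quotient of $\mathcal C(G)$ by the following relations (they generate a coideal, so $\delta$ descends): (i) First shuffles: $\sum_{\sigma\in\Sigma_{r,s}}C(x_0,x_{\sigma^{-1}(1)},\dots,x_{\sigma^{-1}(r+s)})=0$ for $r,s\ge1$, where $\Sigma_{r,s}\subset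 S_{r+s}$ is the set of permutations with $\sigma(1)<\dots<\sigma(r)$ and $\sigma(r+1)<\dots<\sigma(r+s)$. (ii) Scaling: in weight 1, $C(0,0)=0$ and $C(ab,ac)=C(0,a)+C(b,c)$ for $a\in G$ and $b,c\in G\cup\{0\}$ not both $0$; in weight $n>1$, $C(x_0,\dots,x_n)=C(ax_0,\dots,ax_n)$ for $a\in G$. (iii) Distribution: for $l\in\mathbb{Z}_{>0}$, let $G_l$ be the $l$-torsion of $G$; if $G_l$ is finite, $l$ divides $|G_l|$, and $x_0,\dots,x_n\in G\cup\{0\}$ are all $l$-th powers, with $m$ of the $x_i$ equal to $0$, then $C(x_0,\dots,x_n)=\frac{l^m}{|G_l|}\sum_{y_i^l=x_i}C(y_0,\dots,y_n)$, except in the case $n=1$, $x_0=x_1$. **Notation.** For $v_0,\dots,v_k\in G$ with $v_0\cdots v_k=1$ and $m_i\ge0$ (with $0^m$ meaning $m$ consecutive zeros), $$C^*(v_0|m_0,\dots,v_k|m_k):=C(0^{m_0},1,0^{m_1},v_1,0^{m_2},v_1v_2,\dots,0^{m_k},v_1\cdots v_k).$$ **Second shuffles.** Let $\overline\Sigma_{r,s}$ be the set of surjective maps $\sigma:\{1,\dots,r+s\}\to\{1,\dots,M_\sigma\}$ strictly increasing on $\{1,\dots,r\}$ and on $\{r+1,\dots,r+s\}$. For a set $S$ of indices put $n_S=\sum_{i\in S}(n_i+1)-1$, $w_S=\prod_{i\in S}w_i$. A second shuffle is an element $$\sum_{\sigma\in\overline\Sigma_{r,s}}(-1)^{r+s-M_\sigma}C^*\big(w_{\sigma^{-1}(1)}|n_{\sigma^{-1}(1)},\dots,w_{\sigma^{-1}(M_\sigma)}|n_{\sigma^{-1}(M_\sigma)},w_0|n_0\big)$$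 $$-C^*\big(w_1|n_1,\dots,w_r|n_r,w_{\{r+1,\dots,r+s,0\}}|n_{\{r+1,\dots,r+s,0\}}\big)-C^*\big(w_{r+1}|n_{r+1},\dots,w_{r+s}|n_{r+s},w_{\{1,\dots,r,0\}}|n_{\{1,\dots,r,0\}}\big),$$ with $r,s\ge1$, $w_0,\dots,w_{r+s}\in G$, $w_0\cdots w_{r+s}=1$, and integers $n_i\ge0$.
   Formalization: The claims about the coproduct on D~(G) assume that δ descends to D~(G), which fails for some G, e.g. Z^2 x (Z/2)^2 with l=2; for every G it is still stated that δ of the span of second shuffles in C(G) maps into the image of J⊗D~(G). *)

(* Defs.v *)
From HB Require Import structures.
From mathcomp Require Import all_boot all_algebra perm.
From mathcomp Require Import finmap boolp.
From mathcomp Require Import monalg.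

Set Implicit Arguments.
Unset Strict Implicit.
Unset Printing Implicit Defensive.

Import GRing.Theory.

Local Open Scope ring_scope.
Local Open Scope quotient_scope.

Inductive lspan (F : fieldType) (V : lmodType F) (S : V -> Prop) : V -> Prop :=
| span_gen u : S u -> lspan S u
| span_zero : lspan S 0
| span_lin a u v : lspan S u -> lspan S v -> lspan S (a *: u + v).

Section Quotient.
Variables (F : fieldType) (V : lmodType F) (S : V -> Prop).

Definition spanb : {pred V} := fun v => `[< lspan S v >].

Fact spanb_closed : GRing.subsemimod_closed spanb.
Proof.
split; first split; rewrite ?unfold_in.
- by apply/asboolP/span_zero.
- move=> u v /asboolP Su /asboolP Sv; apply/asboolP.
  by rewrite -[u]scale1r; apply: span_lin.
- move=> a u /asboolP Su; apply/asboolP.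
  by rewrite -[_ *: _]addr0; apply: span_lin => //; apply: span_zero.
Qed.

HB.instance Definition _ := GRing.isSubmodClosed.Build F V spanb spanb_closed.

Local Notation ZQ := (@Quotient.quot V spanb).

(* The quotient of V by the subspace spanned by S; S need not be a subspace. *)
Definition quot : Type := ZQ.

HB.instance Definition _ := GRing.Zmodule.on quot.

Definition proj (v : V) : quot := \pi_ZQ v.

Definition lift_repr (q : quot) : V := repr (q : ZQ).

Lemma lift_reprK q : proj (lift_repr q) = q.
Proof. exact: (@reprK _ ZQ). Qed.

Lemma proj_eqP u v : proj u = proj v <-> lspan S (u - v).
Proof.
have E : (proj u == proj v) = spanb (u - v).
  exact: (esym (Quotient.idealrBE spanb u v)).
split; first by move/eqP; rewrite E => /asboolP.
by move=> Suv; apply/eqP; rewrite E; apply/asboolP.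
Qed.

Fact proj_zmod_morphism : zmod_morphism proj.
Proof. exact: (@pi_is_zmod_morphism _ _ _ ZQ). Qed.

HB.instance Definition _ := GRing.isZmodMorphism.Build V quot proj
  proj_zmod_morphism.

Definition quot_scale (a : F) (q : quot) : quot := proj (a *: lift_repr q).

Fact quot_scale_proj a v : quot_scale a (proj v) = proj (a *: v).
Proof.
apply/proj_eqP; rewrite -scalerBr -[_ *: _]addr0.
apply: span_lin; last exact: span_zero.
by apply/proj_eqP; rewrite lift_reprK.
Qed.

Fact quot_scaleA a b q : quot_scale a (quot_scale b q) = quot_scale (a * b) q.
Proof. by rewrite -[q]lift_reprK !quot_scale_proj scalerA. Qed.

Fact quot_scale1 : left_id 1 quot_scale.
Proof. by move=> q; rewrite -[q]lift_reprK quot_scale_proj scale1r. Qed.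

Fact quot_scaleDr : right_distributive quot_scale +%R.
Proof.
move=> a p q; rewrite -[p]lift_reprK -[q]lift_reprK.
by rewrite -raddfD !quot_scale_proj scalerDr raddfD.
Qed.

Fact quot_scaleDl q : {morph quot_scale^~ q : a b / a + b}.
Proof.
move=> a b; rewrite -[q]lift_reprK.
by rewrite !quot_scale_proj scalerDl raddfD.
Qed.

HB.instance Definition _ := GRing.Zmodule_isLmodule.Build F quot
  quot_scaleA quot_scale1 quot_scaleDr quot_scaleDl.

Fact proj_scalable : scalable proj.
Proof. by move=> a v; rewrite -quot_scale_proj. Qed.

HB.instance Definition _ := GRing.isScalable.Build F V quot *:%R proj
  proj_scalable.

Lemma proj_gen u : S u -> proj u = 0.
Proof.
by move=> Su; rewrite -(raddf0 proj); apply/proj_eqP; rewrite subr0;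
  apply: span_gen.
Qed.

Section Lift.
Variables (W : lmodType F) (f : {linear V -> W}).
Hypothesis fS : forall u, S u -> f u = 0.

(* The linear map induced by f on the quotient; the proof argument is only used
   by the linear structure declared on [quot_lift fS]. *)
Definition quot_lift of (forall u, S u -> f u = 0) :=
  fun q : quot => f (lift_repr q).

Lemma quot_lift_proj v : quot_lift fS (proj v) = f v.
Proof.
apply/eqP; rewrite -subr_eq0 -(linearB f); apply/eqP.
have : lspan S (lift_repr (proj v) - v) by apply/proj_eqP; rewrite lift_reprK.
elim=> [u|| a u w _ fu _ fw]; [exact: fS | exact: (linear0 f) |].
by rewrite (linearP f) fu fw scaler0 addr0.
Qed.

Fact quot_lift_linear : linear (quot_lift fS).
Proof.
move=> a p q; rewrite -[p]lift_reprK -[q]lift_reprK -(linearP proj).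
by rewrite !quot_lift_proj linearP.
Qed.

HB.instance Definition _ := GRing.isLinear.Build F quot W *:%R (quot_lift fS)
  quot_lift_linear.

End Lift.
End Quotient.

Arguments proj {F V} S v.

(* {malg F[K]} is the F-vector space with basis K; << k >> is the basis element
   attached to k. *)
Section LinearExtension.
Variables (F : fieldType) (K : choiceType) (W : lmodType F) (f : K -> W).

Definition lin_ext (g : {malg F[K]}) : W := \sum_(k <- msupp g) g@_k *: f k.

Fact lin_extE (d : {fset K}) g : (msupp g `<=` d)%fset ->
  lin_ext g = \sum_(k <- d) g@_k *: f k.
Proof.
move=> le_gd; rewrite /lin_ext (big_fset_incl _ le_gd) //=.
by move=> k _ /mcoeff_outdom ->; rewrite scale0r.
Qed.

Fact lin_ext_linear : linear lin_ext.
Proof.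
move=> a u v; pose d := (msupp (a *: u + v) `|` (msupp u `|` msupp v))%fset.
rewrite !(@lin_extE d) /d ?fsubsetUl //.
- rewrite scaler_sumr -big_split; apply: eq_bigr => k _ /=.
  by rewrite mcoeffD mcoeffZ scalerDl scalerA.
- by rewrite fsetUA fsubsetUr.
- by rewrite fsetUCA fsubsetUl.
Qed.

HB.instance Definition _ := GRing.isLinear.Build F {malg F[K]} W *:%R lin_ext
  lin_ext_linear.

Lemma lin_extU k : lin_ext << k >> = f k.
Proof. by rewrite /lin_ext msuppU oner_eq0 big_seq_fset1 mcoeffUU scale1r. Qed.

End LinearExtension.

Section ExteriorSquare.
Variables (F : fieldType) (V : lmodType F).

Notation free2 := {malg F[(V * V)%type]}.
Notation "u ** v" := (<< (u, v) >> : free2) (at level 40).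

Inductive ext2_rel : free2 -> Prop :=
| ext2_linl a u v w : ext2_rel ((a *: u + v) ** w - (a *: (u ** w) + v ** w))
| ext2_linr a u v w : ext2_rel (w ** (a *: u + v) - (a *: (w ** u) + w ** v))
| ext2_alt u : ext2_rel (u ** u).

Definition ext2 : lmodType F := quot ext2_rel.

Definition wedge (u v : V) : ext2 := proj ext2_rel << (u, v) >>.

Lemma wedge_linl w a u v :
  wedge (a *: u + v) w = a *: wedge u w + wedge v w.
Proof.
rewrite /wedge -(linearP (proj _)); apply/proj_eqP; apply: span_gen.
exact: ext2_linl.
Qed.

Lemma wedge_linr w a u v :
  wedge w (a *: u + v) = a *: wedge w u + wedge w v.
Proof.
rewrite /wedge -(linearP (proj _)); apply/proj_eqP; apply: span_gen.
exact: ext2_linr.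
Qed.

Lemma wedge_alt u : wedge u u = 0.
Proof. exact/proj_gen/ext2_alt. Qed.

(* The image of J (x) V in the exterior square of V, for a subspace J of V. *)
Definition wedge_ideal (J : V -> Prop) : ext2 -> Prop :=
  lspan (fun e => exists u v, J u /\ e = wedge u v).

End ExteriorSquare.

Section ExteriorMap.
Variables (F : fieldType) (V W : lmodType F) (f : {linear V -> W}).

Let ext2_map_gen : {linear {malg F[(V * V)%type]} -> ext2 W} :=
  lin_ext (fun p : V * V => wedge (f p.1) (f p.2)).

Fact ext2_map_subproof e : ext2_rel e -> ext2_map_gen e = 0.
Proof.
case=> [a u v w|a u v w|u].
- by rewrite (linearB ext2_map_gen) (linearP ext2_map_gen) /= !lin_extU /=
    (linearP f) wedge_linl subrr.
- by rewrite (linearB ext2_map_gen) (linearP ext2_map_gen) /= !lin_extU /=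
    (linearP f) wedge_linr subrr.
- by rewrite /= lin_extU wedge_alt.
Qed.

Definition ext2_map : {linear ext2 V -> ext2 W} :=
  quot_lift ext2_map_subproof.

Lemma ext2_map_wedge u v : ext2_map (wedge u v) = wedge (f u) (f v).
Proof.
change (quot_lift ext2_map_subproof (proj (@ext2_rel F V) << (u, v) >>)
        = wedge (f u) (f v)).
by rewrite (@quot_lift_proj F _ _ _ ext2_map_gen) /ext2_map_gen /= lin_extU.
Qed.

End ExteriorMap.

(* The abelian group G is written additively, as is usual for a zmodType.
   In [option G], [Some g] is the element g of G -- so that [Some 0] is the
   unit 1 of the multiplicative notation -- and [None] is the adjoined
   absorbing element 0. *)

Section Words.
Variable G : zmodType.

Definition letter : Type := option G.
HB.instance Definition _ := Choice.on letter.

Definition zero_letter : letter := None.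

Definition lscale (a : G) (x : letter) : letter := omap (fun g => a + g) x.

(* x |-> x ^ l; only meaningful for l > 0, since it fixes the letter 0. *)
Definition lpow (l : nat) (x : letter) : letter := omap (fun g => g *+ l) x.

Definition word : Type := seq letter.
HB.instance Definition _ := Choice.on word.

(* The tensor algebra of the vector space with basis [letter]; the word
   [:: x_0; ...; x_n] stands for x_0 (x) ... (x) x_n. *)
Definition tensor : lmodType rat := {malg rat[word]}.

End Words.

Lemma sum_rot1 (T : Type) (W : zmodType) (f : seq T -> W) (s : seq T) :
  \sum_(k < size s) f (rot k (rot 1 s)) = \sum_(k < size s) f (rot k s).
Proof.
have rotE k : (k < size s)%N -> rot k (rot 1 s) = rot k.+1 s.
  by move=> lt_ks; rewrite rot_rot -rotS.
case E : (size s) => [|m]; first by rewrite !big_ord0.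
rewrite big_ord_recr [RHS]big_ord_recl [RHS]addrC; congr (_ + f _).
  by apply: eq_bigr => k _; rewrite rotE // E (leq_trans (ltn_ord k)).
by rewrite rotE ?E //= -E rot_size rot0.
Qed.

Section Cyclic.
Variable G : zmodType.

(* A word of size n.+1 has weight n. Only the weights n >= 1 are kept, so the
   words of size less than 2 are killed. *)
Inductive cyc_rel : tensor G -> Prop :=
| cyc_short (s : word G) : (size s < 2)%N -> cyc_rel << s >>
| cyc_rot (s : word G) : cyc_rel (<< s >> - << rot 1 s >>).

Definition cyc : lmodType rat := quot cyc_rel.

(* C [:: x_0; ...; x_n] is C(x_0, ..., x_n); it is 0 on words of size < 2. *)
Definition C (s : word G) : cyc := proj cyc_rel << s >>.

Lemma C_rot1 s : C (rot 1 s) = C s.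
Proof.
by apply/esym/proj_eqP; apply: span_gen; apply: cyc_rot.
Qed.

(* For t = (x_0, ..., x_n), so that n = (size t).-1:
   sum_{i=1}^{n-1} C(x_0, x_1, ..., x_i) /\ C(x_0, x_{i+1}, ..., x_n). *)
Definition cuts (t : word G) : ext2 cyc :=
  \sum_(1 <= i < (size t).-1)
    wedge (C (take i.+1 t)) (C (take 1 t ++ drop i.+1 t)).

Definition delta_word (s : word G) : ext2 cyc :=
  \sum_(k < size s) cuts (rot k s).

Lemma delta_word_rot1 s : delta_word (rot 1 s) = delta_word s.
Proof. by rewrite /delta_word size_rot; apply: sum_rot1. Qed.

Let delta_gen : {linear tensor G -> ext2 cyc} := lin_ext delta_word.

Fact delta_subproof t : cyc_rel t -> delta_gen t = 0.
Proof.
case=> [s s_lt2|s]; last first.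
  by rewrite (linearB delta_gen) /= !lin_extU delta_word_rot1 subrr.
rewrite /= lin_extU /delta_word big1 // => k _.
by rewrite /cuts size_rot big_geq //; case: (size s) s_lt2 => [|[|[]]].
Qed.

Definition delta : {linear cyc -> ext2 cyc} := quot_lift delta_subproof.

Lemma delta_C s : delta (C s) = delta_word s.
Proof.
change (quot_lift delta_subproof (proj cyc_rel << s >>) = delta_word s).
by rewrite (@quot_lift_proj _ _ _ _ delta_gen) /delta_gen /= lin_extU.
Qed.

End Cyclic.

(* Both kinds of shuffles are indexed by functions on {1, ..., r + s} that are
   strictly increasing on {1, ..., r} and on {r + 1, ..., r + s}; the ordinal
   i : 'I_(r + s) stands for the index i.+1. *)
Definition block_increasing (m r : nat) (f : 'I_m -> nat) : bool :=
  [forall i : 'I_m, forall j : 'I_m,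
    (i < j)%N && ((i < r)%N == (j < r)%N) ==> (f i < f j)%N].

Section Dihedral.
Variable G : zmodType.

Definition first_shuffle (r s : nat) (x0 : letter G)
    (x : 'I_(r + s) -> letter G) : cyc G :=
  \sum_(sigma : 'S_(r + s) | block_increasing r (fun i => val (sigma i)))
    C (x0 :: [seq x ((sigma^-1)%g i) | i <- enum 'I_(r + s)]).

Definition enumerates (T : eqType) (e : seq T) (P : T -> Prop) : Prop :=
  uniq e /\ forall t, t \in e <-> P t.

(* y = (y_0, ..., y_n) with y_i ^ l = x_i for all i *)
Definition is_root (l : nat) (x y : word G) : Prop := map (lpow l) y = x.

(* The relations (first shuffles, scaling, distribution) that define the
   quotient \widetilde{D}(G) of C(G); it is called Dt(G) below. *)
Inductive Dt_rel : cyc G -> Prop :=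
| Dt_shuffle (r s : nat) (x0 : letter G) (x : 'I_(r + s) -> letter G) :
    (0 < r)%N -> (0 < s)%N -> Dt_rel (first_shuffle x0 x)
| Dt_zero : Dt_rel (C [:: zero_letter G; zero_letter G])
| Dt_scale1 (a : G) (b c : letter G) :
    ~ (b = zero_letter G /\ c = zero_letter G) ->
    Dt_rel (C [:: lscale a b; lscale a c]
            - (C [:: zero_letter G; Some a] + C [:: b; c]))
| Dt_scale (a : G) (x : word G) : (2 < size x)%N ->
    Dt_rel (C x - C (map (lscale a) x))
(* tors enumerates the l-torsion subgroup G_l, so that size tors = |G_l|, and
   roots enumerates the tuples of l-th roots of the x_i; the count is the number
   m of zeros among the x_i. *)
| Dt_distribution (l : nat) (tors : seq G) (x : word G) (roots : seq (word G)) :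
    (0 < l)%N ->
    enumerates tors (fun g => g *+ l = 0) ->
    (l %| size tors)%N ->
    (1 < size x)%N ->
    (exists y, is_root l x y) ->
    enumerates roots (is_root l x) ->
    ~ (exists a, x = [:: a; a]) ->
    Dt_rel (C x - (l ^ count_mem (zero_letter G) x)%N%:R / (size tors)%:R
                  *: \sum_(y <- roots) C y).

Definition Dt : lmodType rat := quot Dt_rel.

Definition to_Dt : {linear cyc G -> Dt} := proj Dt_rel.

(* C^*(v_0|m_0, ..., v_k|m_k) for vm = [:: (v_0, m_0); ...; (v_k, m_k)]: the
   j-th block is 0^{m_j}, v_1 ... v_j. *)
Definition Cstar (vm : seq (G * nat)) : cyc G :=
  let v j := (nth (0, 0%N) vm j).1 in
  let m j := (nth (0, 0%N) vm j).2 in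
  C (flatten (mkseq (fun j =>
       rcons (nseq (m j) (zero_letter G)) (Some (\sum_(1 <= i < j.+1) v i)))
     (size vm))).

Section SecondShuffle.
Variables (r s : nat) (w : 'I_(r + s).+1 -> G) (n : 'I_(r + s).+1 -> nat).

(* (w_A, n_A), for A nonempty *)
Definition merged (A : {set 'I_(r + s).+1}) : G * nat :=
  (\sum_(i in A) w i, (\sum_(i in A) (n i).+1).-1).

(* The surjections of {1, ..., r + s} onto {1, ..., M} that occur in a second
   shuffle; {1, ..., r + s} is the image of [lift ord0] in {0, ..., r + s}. *)
Definition quasi_shuffle (M : nat) (sigma : {ffun 'I_(r + s) -> 'I_M}) : bool :=
  [forall k, exists i, sigma i == k]
  && block_increasing r (fun i => val (sigma i)).

Definition fiber (M : nat) (sigma : {ffun 'I_(r + s) -> 'I_M}) (k : 'I_M) :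
    {set 'I_(r + s).+1} :=
  [set lift ord0 i | i in [set i | sigma i == k]].

Definition block1 : {set 'I_(r + s).+1} :=
  [set i : 'I_(r + s).+1 | (0 < i <= r)%N].
Definition block2 : {set 'I_(r + s).+1} :=
  [set i : 'I_(r + s).+1 | (r < i)%N].

Definition second_shuffle : cyc G :=
  \sum_(M < (r + s).+1)
    \sum_(sigma : {ffun 'I_(r + s) -> 'I_M} | quasi_shuffle sigma)
      (-1) ^+ (r + s - M)
      *: Cstar (rcons [seq merged (fiber sigma k) | k <- enum 'I_M]
                      (w ord0, n ord0))
  - Cstar (rcons [seq (w i, n i) | i <- enum block1] (merged (ord0 |: block2)))
  - Cstar (rcons [seq (w i, n i) | i <- enum block2] (merged (ord0 |: block1))).

End SecondShuffle.

Definition is_second_shuffle (z : cyc G) : Prop :=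
  exists (r s : nat) (w : 'I_(r + s).+1 -> G) (n : 'I_(r + s).+1 -> nat),
    [/\ (0 < r)%N, (0 < s)%N, \sum_i w i = 0 & z = second_shuffle w n].

Definition second_shuffle_Dt (u : Dt) : Prop :=
  exists2 z, is_second_shuffle z & u = to_Dt z.

Definition J : Dt -> Prop := lspan second_shuffle_Dt.

Definition D : lmodType rat := quot second_shuffle_Dt.

Definition to_D : {linear Dt -> D} := proj second_shuffle_Dt.

(* [d] is the coproduct induced on Dt(G) by the coproduct of C(G). *)
Definition Dt_coproduct (d : {linear Dt -> ext2 Dt}) : Prop :=
  forall z : cyc G, d (to_Dt z) = ext2_map to_Dt (delta G z).

End Dihedral.

(* Main.v *)
(* Let c(x_0, ..., x_n) be the image of C(x_0, ..., x_n) in D(G). Put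
   f(u) = c(1 u) - c(0 u) and f_z(u) = c(z u) - c(0 u), and let f_m(U) be the
   value of f on the word with blocks U = (v_1|n_1), ..., (v_k|n_k) followed by
   0^m. Second shuffles vanish if and only if f_m kills the quasi-shuffle
   products of nonempty words in the letters (v|n); there is a mirror version in
   which c(.. z) - c(.. 0) replaces f.

   In the difference delta c(1 u) - delta c(0 u), the terms that come from the
   cutting letter 0 telescope, and the rest is
     sum_{u = P Q} f(P) /\ f(Q) + sum_{u = a P z b} f(a z b) /\ f_z(P)
       - sum_{u = a z P b} f(a z b) /\ f_z(P).
   On block words this is f(T U) plus a deconcatenation term
   sum_{U = A B} f(A) /\ f(B) plus a term with log = c(0, .), where T replaces a
   factor P of U by single letters, tau(P). The point is that T is a derivation
   of the quasi-shuffle product. As T acts locally, it suffices to compute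
   tau(P * Q): this vanishes when P and Q both have at least two letters, by the
   quasi-shuffle relations for f and for its mirror version, while for P = y a
   single letter it differs from minus the merging of y into tau(Q) by an
   expression that cancels because c is invariant under cyclic permutation.
   Hence delta f kills quasi-shuffle products too, since /\ is alternating. *)

Require Import Defs.
From mathcomp Require Import all_boot all_algebra perm.
From mathcomp Require Import boolp zify.

Import GRing.Theory.
Local Open Scope ring_scope.

Set Implicit Arguments.
Unset Strict Implicit.
Unset Printing Implicit Defensive.

(** * Identities in abelian groups *)

(** Syntax for a reflective decision procedure: in every abelian group an identity follows once the
    integer coefficients of each atom agree, which is checked by computation. *)
Inductive zexpr := ZVar of nat | ZZero | ZAdd of zexpr & zexpr | ZOpp of zexpr.

Fixpoint zeval (V : zmodType) (env : seq V) (e : zexpr) : V :=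
  match e with
  | ZVar n => nth 0 env n
  | ZZero => 0
  | ZAdd a b => zeval env a + zeval env b
  | ZOpp a => - zeval env a
  end.

Fixpoint zcoef (e : zexpr) (n : nat) : int :=
  match e with
  | ZVar m => (m == n)%:Z
  | ZZero => 0
  | ZAdd a b => zcoef a n + zcoef b n
  | ZOpp a => - zcoef a n
  end.

Lemma zevalE (V : zmodType) (env : seq V) (e : zexpr) :
  zeval env e = \sum_(n < size env) env`_n *~ zcoef e n.
Proof.
elim: e => /= [m||a -> b ->|a ->].
- have [lt_m|le_m] := ltnP m (size env).
    rewrite (bigD1 (Ordinal lt_m)) //= eqxx mulr1z big1 ?addr0 // => i ne_i.
    by rewrite (_ : (m == i) = false) ?mulr0z //; apply/negP => /eqP mi;
      case/eqP: ne_i; apply: val_inj.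
  rewrite nth_default // big1 // => i _; rewrite (_ : (m == i) = false) //.
  by apply/negP => /eqP mi; move: (ltn_ord i); rewrite -mi ltnNge le_m.
- by rewrite big1 // => i _; rewrite mulr0z.
- by rewrite -big_split; apply: eq_bigr => i _; rewrite mulrzDr.
- by rewrite -sumrN; apply: eq_bigr => i _; rewrite mulrNz.
Qed.

Lemma zeval_eq (V : zmodType) (env : seq V) (a b : zexpr) :
  all (fun n => zcoef a n == zcoef b n) (iota 0 (size env)) ->
  zeval env a = zeval env b.
Proof.
move=> /allP ab; rewrite !zevalE; apply: eq_bigr => i _.
by rewrite (eqP (ab i _)) // mem_iota ltn_ord.
Qed.

(* Atoms are compared up to conversion, since lemmas may leave different but
   convertible canonical instances in them. *)
Ltac zindex x env :=
  match env with
  | x :: _ => constr:(0%N)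
  | _ :: ?r => let n := zindex x r in constr:(n.+1)
  | ?y :: _ => let _ := match goal with _ => unify x y end in constr:(0%N)
  end.

Ltac zadd x env :=
  match env with
  | _ => let n := zindex x env in env
  | _ => constr:(x :: env)
  end.

Ltac zatoms e env :=
  lazymatch e with
  | ?a + ?b => let env1 := zatoms a env in zatoms b env1
  | - ?a => zatoms a env
  | 0 => env
  | ?x => zadd x env
  end.

Ltac zquote e env :=
  lazymatch e with
  | ?a + ?b => let x := zquote a env in let y := zquote b env in
               constr:(ZAdd x y)
  | - ?a => let x := zquote a env in constr:(ZOpp x)
  | 0 => constr:(ZZero)
  | ?x => let n := zindex x env in constr:(ZVar n)
  end.

(* [ring] does not apply to a bare zmodType. *)
Ltac abel :=
  lazymatch goal with
  | |- @eq ?V ?a ?b =>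
    let env0 := constr:(@nil V) in
    let env1 := zatoms a env0 in
    let env := zatoms b env1 in
    let x := zquote a env in
    let y := zquote b env in
    apply: (@zeval_eq _ env x y); by vm_compute
  end.

(** * Sums over decompositions of a word *)

(** The sums below, over cuts, quasi-shuffles and substitutions, all take their summand as a
    function argument; additivity in it is what lets two such sums be interchanged. *)
Definition additive_functional (I : Type) (V W : zmodType)
    (L : (I -> V) -> W) : Prop :=
  forall h k, L (fun i => h i + k i) = L h + L k.

Section AdditiveFunctional.
Variables (I : Type) (V W : zmodType) (L : (I -> V) -> W).
Hypothesis LD : additive_functional L.

Lemma functional0 : L (fun=> 0) = 0.
Proof.
by apply: (addrI (L (fun=> 0))); rewrite -LD !addr0.
Qed.

Lemma functionalN h : L (fun i => - h i) = - L h.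
Proof.
apply/eqP; rewrite -addr_eq0 -LD; apply/eqP.
rewrite -[RHS]functional0; congr (L _).
by apply/funext=> i; rewrite addNr.
Qed.

Lemma functionalB h k : L (fun i => h i - k i) = L h - L k.
Proof. by rewrite LD functionalN. Qed.

Lemma functional_sum (J : Type) (r : seq J) (P : pred J) (h : J -> I -> V) :
  L (fun i => \sum_(j <- r | P j) h j i) = \sum_(j <- r | P j) L (h j).
Proof.
elim: r => [|j r IHr].
  by rewrite big_nil -functional0; congr (L _); apply/funext => i;
    rewrite big_nil.
rewrite big_cons; have [Pj|/negPf nPj] := boolP (P j).
  rewrite -IHr -LD; congr (L _).
  by apply/funext => i; rewrite big_cons Pj.
by rewrite -IHr; congr (L _); apply/funext => i; rewrite big_cons nPj.
Qed.

End AdditiveFunctional.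

Section Cut.
Variable T : Type.

(* The sums of h over the decompositions s = a ++ b, resp. s = a ++ x :: b;
   [onlast] is h on the decomposition of s into its last letter and the rest. *)
Fixpoint cut (W : zmodType) (s : seq T) (h : seq T -> seq T -> W) : W :=
  if s is x :: s' then h [::] s + cut s' (fun a b => h (x :: a) b)
  else h [::] [::].

Definition mark (W : zmodType) (s : seq T) (h : seq T -> T -> seq T -> W) : W :=
  cut s (fun a b => if b is x :: b' then h a x b' else 0).

Definition onlast (W : zmodType) (s : seq T) (h : seq T -> T -> W) : W :=
  if s is x :: s' then h (belast x s') (last x s') else 0.

Variable W : zmodType.
Implicit Types (s : seq T) (h : seq T -> seq T -> W).

Lemma eq_cut s h k : (forall a b, a ++ b = s -> h a b = k a b) ->
  cut s h = cut s k.
Proof.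
elim: s h k => [|x s IHs] h k hk /=; first exact: hk.
rewrite hk //; congr (_ + _); apply: IHs => a b ab_s.
by apply: hk; rewrite /= ab_s.
Qed.

Lemma cut_additive s :
  additive_functional (fun h : seq T * seq T -> W => cut s (fun a b => h (a,
    b))).
Proof.
elim: s => [|x s IHs] h k //=.
have /= -> := IHs (fun p => h (x :: p.1, p.2)) (fun p => k (x :: p.1, p.2)).
by rewrite addrACA.
Qed.

Lemma cutD s h k : cut s (fun a b => h a b + k a b) = cut s h + cut s k.
Proof. exact: (cut_additive s (fun p => h p.1 p.2) (fun p => k p.1 p.2)). Qed.

Lemma cut0 s : cut s (fun _ _ => 0 : W) = 0.
Proof. exact: functional0 (cut_additive s). Qed.

Lemma cutN s h : cut s (fun a b => - h a b) = - cut s h.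
Proof.
exact: (functionalN (cut_additive s) (fun p => h p.1 p.2)).
Qed.

Lemma cutB s h k : cut s (fun a b => h a b - k a b) = cut s h - cut s k.
Proof. by rewrite cutD cutN. Qed.

Lemma cut_exchange (I : Type) (V : zmodType) (L : (I -> V) -> W) s
    (h : I -> seq T -> seq T -> V) :
  additive_functional L ->
  L (fun i => cut s (h i)) = cut s (fun a b => L (fun i => h i a b)).
Proof. by move=> LD; elim: s h => //= x s IHs h; rewrite LD IHs. Qed.

Lemma cut_nil s (g : seq T -> W) :
  cut s (fun a b => if a is [::] then g b else 0) = g s.
Proof. by case: s => //= x s; rewrite cut0 addr0. Qed.

Lemma cut_nilr s (g : seq T -> W) :
  cut s (fun a b => if b is [::] then g a else 0) = g s.
Proof. by elim: s g => //= x s IHs g; rewrite add0r (IHs (fun a =>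
  g (x :: a))). Qed.

Lemma cut_seq1 s (g : T -> seq T -> W) :
  cut s (fun a b => if a is [:: x] then g x b else 0)
  = if s is x :: s' then g x s' else 0.
Proof. by case: s => //= x s; rewrite add0r (cut_nil s (g x)). Qed.

Lemma cut_seq1r s x (g : seq T -> T -> W) :
  cut (rcons s x) (fun a b => if b is [:: z] then g a z else 0) = g s x.
Proof.
elim: s g => [|y s IHs] g /=; first by rewrite addr0.
by rewrite (IHs (fun a => g (y :: a))); case: s {IHs} => [|? ?]; rewrite add0r.
Qed.

Lemma cut_sum s h :
  cut s h = \sum_(i < (size s).+1) h (take i s) (drop i s).
Proof.
elim: s h => [|x s IHs] h /=; first by rewrite big_ord_recl big_ord0 addr0.
by rewrite big_ord_recl /= IHs.
Qed.

(** Coassociativity of deconcatenation. *)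
Lemma cutA s (h : seq T -> seq T -> seq T -> W) :
  cut s (fun a b => cut a (fun a1 a2 => h a1 a2 b))
  = cut s (fun a r => cut r (fun b c => h a b c)).
Proof.
elim: s h => [|x s IHs] h //=.
by rewrite cutD IHs /= addrA.
Qed.

Lemma cut_cat_cons s x t h :
  cut (s ++ x :: t) h = cut s (fun a b => h a (b ++ x :: t))
    + cut t (fun a b => h (s ++ x :: a) b).
Proof. by elim: s h => //= y s IHs h; rewrite IHs addrA. Qed.

Lemma eq_mark s (h k : seq T -> T -> seq T -> W) :
  (forall a x b, a ++ x :: b = s -> h a x b = k a x b) -> mark s h = mark s k.
Proof. by move=> hk; apply: eq_cut => a [|x b] //; apply: hk. Qed.

Lemma markD s (h k : seq T -> T -> seq T -> W) :
  mark s (fun a x b => h a x b + k a x b) = mark s h + mark s k.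
Proof. by rewrite -cutD; apply: eq_cut => a [|x b] _; rewrite ?addr0. Qed.

Lemma markN s (h : seq T -> T -> seq T -> W) :
  mark s (fun a x b => - h a x b) = - mark s h.
Proof. by rewrite -cutN; apply: eq_cut => a [|x b] _; rewrite ?oppr0. Qed.

Lemma mark_cons y s (h : seq T -> T -> seq T -> W) :
  mark (y :: s) h = h [::] y s + mark s (fun a => h (y :: a)).
Proof. by []. Qed.

Lemma cut_mark s h :
  cut s h = h [::] s + mark s (fun a x b => h (rcons a x) b).
Proof.
elim: s h => [|x s IHs] h /=; first by rewrite addr0.
by rewrite IHs mark_cons.
Qed.

Lemma cut_mark_last s h :
  cut s h = mark s (fun a x b => h a (x :: b)) + h s [::].
Proof.
elim: s h => [|x s IHs] h /=; first by rewrite add0r.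
by rewrite IHs mark_cons addrA.
Qed.

Lemma onlast_rcons s x (h : seq T -> T -> W) : onlast (rcons s x) h = h s x.
Proof. by case: s => //= y s; rewrite belast_rcons last_rcons. Qed.

Lemma mark_onlast s (h : seq T -> T -> seq T -> W) :
  mark s h = cut s (fun p b => onlast p (fun a x => h a x b)).
Proof.
rewrite cut_mark add0r; apply: eq_mark => a x b _.
by rewrite onlast_rcons.
Qed.

(** Both sides run over splittings into a prefix, a letter and a rest. On the left the rest ends
    with the last letter of [s], hence is nonempty; the hypothesis on [g] removes the empty rest on
    the right. *)
Lemma onlast_mark s (g : seq T -> T -> seq T -> W) :
  (forall a x, g a x [::] = 0) ->
  onlast s (fun a y => mark a (fun b x c => g b x (rcons c y))) = mark s g.
Proof.
move=> g0; elim/last_ind: s => [|s y _] //.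
rewrite onlast_rcons; elim: s g g0 => [|x s IHs] g g0 /=.
  by rewrite /mark /= g0 addr0.
by rewrite !mark_cons (IHs (fun b => g (x :: b))).
Qed.

End Cut.


Lemma cut_cut (S T : Type) (W : zmodType) (s : seq S) (t : seq T)
    (h : seq S -> seq S -> seq T -> seq T -> W) :
  cut s (fun a b => cut t (h a b)) = cut t (fun c d => cut s (fun a b =>
    h a b c d)).
Proof. by elim: s h => [|x s IHs] h //=; rewrite IHs -cutD. Qed.

(** * Quasi-shuffles *)

Section Stuffle.
Variables (T : Type) (op : T -> T -> T) (W : zmodType).
Implicit Types (u v : seq T) (H : seq T -> W).

(* The value of the linear extension of H at the quasi-shuffle product of u and
   v, where the merging of two letters is minus their image by op. *)
Fixpoint stuffle u : seq T -> (seq T -> W) -> W :=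
  if u is y :: u' then
    fix stuffle_u v H : W := if v is z :: v' then
      stuffle u' v (fun w => H (y :: w)) + stuffle_u v' (fun w => H (z :: w))
        - stuffle u' v' (fun w => H (op y z :: w))
      else H u
  else fun v H => H v.

Lemma stuffle_nill v H : stuffle [::] v H = H v. Proof. by []. Qed.

Lemma stuffle_nilr u H : stuffle u [::] H = H u. Proof. by case: u. Qed.

Lemma stuffle_cons y u z v H :
  stuffle (y :: u) (z :: v) H =
    stuffle u (z :: v) (fun w => H (y :: w)) + stuffle (y :: u) v (fun w =>
      H (z :: w))
      - stuffle u v (fun w => H (op y z :: w)).
Proof. by []. Qed.

Lemma stuffle_additive u v : additive_functional (stuffle u v).
Proof.
elim: u v => [|y u IHu] v H K //; elim: v H K => [|z v IHv] H K //.
by rewrite !stuffle_cons !IHu IHv; abel.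
Qed.

(** The recursion can start from the last letters as well; the mirror versions of the relations rest
    on this. *)
Lemma stuffle_rcons y u z v H :
  stuffle (rcons u y) (rcons v z) H =
    stuffle u (rcons v z) (fun w => H (rcons w y))
    + stuffle (rcons u y) v (fun w => H (rcons w z))
    - stuffle u v (fun w => H (rcons w (op y z))).
Proof.
elim: u v H => [|x u IHu] v H.
  elim: v H => [|x v IHv] H /=; first by abel.
  by rewrite -/(stuffle [:: y]) IHv; case: (v) => [|t v0] /=; abel.
elim: v H => [|t v IHv] H.
  rewrite rcons_cons [rcons [::] z]/= !stuffle_cons !stuffle_nilr (IHu [::])
    !stuffle_nilr.
  by case: (u) => [|a u0] /=; abel.
rewrite !rcons_cons !stuffle_cons -(rcons_cons x u y) IHv -(rcons_cons t v z)
  !IHu.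
by rewrite /=; abel.
Qed.

End Stuffle.

Arguments stuffle : simpl never.

Section StuffleTheory.
Variables (T : Type) (op : T -> T -> T).
Local Notation stuffle := (@stuffle T op _).

Lemma stuffle_exchange (I : Type) (V W : zmodType) (L : (I -> V) -> W) u v
    (H : I -> seq T -> V) : additive_functional L ->
  L (fun i => stuffle u v (H i)) = stuffle u v (fun w => L (fun i => H i w)).
Proof.
move=> LD; elim: u v H => [|y u IHu] v H //; elim: v H => [|z v IHv] H //.
by rewrite stuffle_cons -!IHu -IHv -LD -(functionalB LD).
Qed.

Variable W : zmodType.
Implicit Types (u v : seq T) (H K : seq T -> W).

(** Words of a quasi-shuffle product are at least as long as each factor, and share the total of any
    statistic [mu] that is additive under merging; only values at such words matter. *)
Lemma eq_stuffle (M : nmodType) (mu : T -> M) u v H K :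
  (forall y z, mu (op y z) = mu y + mu z) ->
  (forall w, (size u <= size w)%N -> (size v <= size w)%N ->
     \sum_(y <- w) mu y = \sum_(y <- u) mu y + \sum_(y <- v) mu y ->
     H w = K w) ->
  stuffle u v H = stuffle u v K.
Proof.
move=> muM; elim: u v H K => [|y u IHu] v H K HK.
  by apply: HK => //; rewrite big_nil add0r.
elim: v H K HK => [|z v IHv] H K HK; first by apply: HK;
  rewrite // big_nil addr0.
rewrite !stuffle_cons; congr (_ + _ - _).
- apply: IHu => w uw vw mw; apply: HK => //; first exact: (leq_trans vw).
  by rewrite !big_cons mw !big_cons addrA.
- apply: IHv => w uw vw mw; apply: HK => //; first exact: (leq_trans uw).
  by rewrite !big_cons mw !big_cons addrCA.
- apply: IHu => w uw vw mw; apply: HK => //.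
  by rewrite !big_cons mw muM addrACA.
Qed.

Lemma eq_stuffle_size u v H K :
  (forall w, (size u <= size w)%N -> (size v <= size w)%N -> H w = K w) ->
  stuffle u v H = stuffle u v K.
Proof.
by move=> HK; apply: (@eq_stuffle int (fun=> 0)) => [y z|w uw vw _];
  [rewrite addr0 | apply: HK].
Qed.

Lemma stuffleD u v H K : stuffle u v (fun w =>
  H w + K w) = stuffle u v H + stuffle u v K.
Proof. exact: stuffle_additive. Qed.

Lemma stuffleB u v H K : stuffle u v (fun w =>
  H w - K w) = stuffle u v H - stuffle u v K.
Proof. exact: functionalB (@stuffle_additive _ _ _ _ _) _ _. Qed.

Lemma stuffle0 u v : stuffle u v (fun=> 0 : W) = 0.
Proof. exact: functional0 (@stuffle_additive _ _ _ _ _). Qed.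

Lemma stuffle_sum u v (J : Type) (r : seq J) (P : pred J) (H : J -> seq T -> W)
  :
  stuffle u v (fun w => \sum_(j <- r | P j) H j w)
  = \sum_(j <- r | P j) stuffle u v (H j).
Proof. exact: (functional_sum (@stuffle_additive T op W u v) r P H). Qed.

(** Deconcatenation is multiplicative for the quasi-shuffle product: the two form a bialgebra. *)
Lemma stuffle_cut u v (h : seq T -> seq T -> W) :
  stuffle u v (fun w => cut w h) =
    cut u (fun u1 u2 => cut v (fun v1 v2 =>
      stuffle u1 v1 (fun a => stuffle u2 v2 (fun b => h a b)))).
Proof.
elim: u v h => [|y u IHu] v h //.
elim: v h => [|z v IHv] h.
  by rewrite stuffle_nilr; apply: eq_cut => u1 u2 _ /=; rewrite !stuffle_nilr.
rewrite /= (stuffle_nill op [::]) !stuffle_cons !stuffleD !IHu IHv /=.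
under [X in _ = _ + X]eq_cut => u1 u2 _.
  rewrite stuffle_nilr; under eq_cut => v1 v2 _ do rewrite stuffle_cons.
  rewrite cutB cutD; over.
under [in RHS]eq_cut => v1 v2 _ do rewrite stuffle_nill.
under eq_cut => u1 u2 _ do rewrite stuffle_nilr.
under [X in _ + (_ + (X + _))]eq_cut => v1 v2 _ do rewrite stuffle_nill.
rewrite !(cutB, cutD); abel.
Qed.

(** The letter [y] either stays alone or merges with a letter [z] of [v]; the parts of [v] before
    and after that place are multiplied with [u] and [u']. *)
Lemma stuffle_mid u y u' v H :
  stuffle (u ++ y :: u') v H =
    cut v (fun v1 v2 => stuffle u v1 (fun a => stuffle u' v2 (fun b =>
      H (a ++ y :: b))))
    - mark v (fun v1 z v2 =>
        stuffle u v1 (fun a => stuffle u' v2 (fun b => H (a ++ op y z :: b)))).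
Proof.
elim: u v H => [|x u IHu] v H /=.
  change (stuffle (y :: u') v H = cut v (fun v1 v2 => stuffle u' v2 (fun b =>
    H (v1 ++ y :: b)))
    - mark v (fun v1 z v2 => stuffle u' v2 (fun b => H (v1 ++ op y z :: b)))).
  elim: v H => [|z v IHv] H; first by rewrite /mark /= subr0 !stuffle_nilr.
  by rewrite stuffle_cons IHv mark_cons /=; abel.
elim: v H => [|z v IHv] H; first by rewrite /mark /= subr0 !stuffle_nilr.
rewrite stuffle_cons !IHu IHv !mark_cons /= !stuffle_nilr.
under [in RHS]eq_cut => v1 v2 _ do rewrite stuffle_cons.
under [in RHS]eq_mark => v1 t v2 _ do rewrite stuffle_cons.
by rewrite !(cutB, cutD) !(markN, markD) /=; abel.
Qed.

End StuffleTheory.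

Lemma stuffle_flip (T : Type) (op : T -> T -> T) (W : zmodType) u v (H : seq T
  -> W) :
  stuffle op u v H = stuffle (fun y z => op z y) v u H.
Proof.
elim: u v H => [|y u IHu] v H; first by rewrite stuffle_nilr.
elim: v H => [|z v IHv] H; first by rewrite stuffle_nilr.
by rewrite !stuffle_cons !IHu IHv; abel.
Qed.

(** * Substitution of factors as a derivation *)

Section Derivation.
Variables (T : Type) (V W : zmodType).
Variable tau : seq T -> (T -> V) -> W.
Hypothesis tauD : forall p, additive_functional (tau p).

(* The sum over the factors p of w, which tau replaces by single letters. *)
Definition substitute w (H : seq T -> V) : W :=
  cut w (fun a r => cut r (fun p b => tau p (fun y => H (a ++ y :: b)))).

(** By [stuffle_mid], the letter that replaces the factor [u2] meets either nothing or one letter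
    [z] of [v]. In a triple cut of [v] this says that the middle part is empty or [[:: z]]. *)
Lemma substitute_stuffle (op : T -> T -> T) u v H :
  substitute u (fun w => stuffle op w v H) =
  cut u (fun u1 u' => cut v (fun v1 v' => stuffle op u1 v1 (fun a =>
    cut u' (fun u2 u3 => cut v' (fun v2 v3 =>
      (if v2 is [::] then
         tau u2 (fun y => stuffle op u3 v3 (fun b => H (a ++ y :: b))) else 0)
      - (if v2 is [:: z] then
         tau u2 (fun y => stuffle op u3 v3 (fun b => H (a ++ op y z :: b)))
         else 0)))))).
Proof.
apply: eq_cut => u1 u' _.
under [RHS]eq_cut => v1 v' _.
  rewrite cut_exchange; last exact: stuffle_additive.
  over.
rewrite cut_cut; apply: eq_cut => u2 u3 _.
have -> : (fun y => stuffle op (u1 ++ y :: u3) v H) = fun y =>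
    cut v (fun v1 v2 => stuffle op u1 v1 (fun a => stuffle op u3 v2 (fun b =>
      H (a ++ y :: b)))
      - if v2 is z :: v2' then 
        stuffle op u1 v1 (fun a => stuffle op u3 v2' (fun b =>
          H (a ++ op y z :: b)))
        else 0).
  by apply/funext => y; rewrite stuffle_mid cutB.
rewrite cut_exchange //; apply: eq_cut => v1 v2 _.
rewrite functionalB // stuffle_exchange //.
under [in RHS]eq_stuffle_size => a _ _.
  rewrite cutB (cut_nil v2 (fun v3 => tau u2 (fun y => stuffle op u3 v3 _))).
  rewrite (cut_seq1 v2 (fun z v3 => tau u2 (fun y =>
    stuffle op u3 v3 (fun b => H (a ++ op y z :: b))))).
  over.
rewrite stuffleB; congr (_ - _).
case: v2 => [|z v2]; first by rewrite (functional0 (tauD u2)) stuffle0.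
exact: (@stuffle_exchange _ op _ _ _ (tau u2) u1 v1 (fun y a =>
  stuffle op u3 v2 (fun b => H (a ++ op y z :: b))) (tauD u2)).
Qed.

Variable op : T -> T -> T.
Hypothesis tau_stuffle : forall u v k, stuffle op u v (fun p => tau p k) =
  (if u is [::] then tau v k else 0) + (if v is [::] then tau u k else 0)
  - (if u is [:: y] then tau v (fun z => k (op y z)) else 0)
  - (if v is [:: z] then tau u (fun y => k (op y z)) else 0).

(** Expanded over triple cuts of both words, the left side contains [tau] of the product of the two
    middle parts, and the right side exactly the four terms of [tau_stuffle]. So the derivation
    property is a local condition on [tau]. *)
Lemma substitute_derivation u v H :
  stuffle op u v (fun w => substitute w H) =
    substitute u (fun w => stuffle op w v H) + substitute v (fun w =>
      stuffle op u w H).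
Proof.
have -> : substitute v (fun w => stuffle op u w H) =
  substitute v (fun w => stuffle (fun y z => op z y) w u H).
  by congr (substitute v _); apply/funext => w; apply: stuffle_flip.
rewrite !substitute_stuffle [X in _ = _ + X]cut_cut stuffle_cut -cutD;
  apply: eq_cut => u1 u' _.
rewrite -cutD; apply: eq_cut => v1 v' _.
rewrite -(stuffle_flip op) -stuffleD; apply: eq_stuffle_size => a _ _.
rewrite stuffle_cut [X in _ = _ + X]cut_cut -cutD; apply: eq_cut => u2 u3 _.
rewrite -cutD; apply: eq_cut => v2 v3 _.
under eq_stuffle_size => p _ _ do rewrite -stuffle_exchange //.
rewrite tau_stuffle.
have flipE (z : T -> T) : (fun y => stuffle (fun y0 z0 =>
  op z0 y0) v3 u3 (fun b => H (a ++ z y :: b)))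
   = (fun y => stuffle op u3 v3 (fun b => H (a ++ z y :: b))).
  by apply/funext => y; rewrite -(stuffle_flip op).
by case: u2 => [|y [|y' u2]]; rewrite ?(flipE id) ?(flipE (op y));
  case: v2 => [|z [|z' v2]]; abel.
Qed.

End Derivation.
(** * The cobracket on block words *)

Section Core.
Variable G : zmodType.
Local Notation Y := (G * nat)%type.
Implicit Types (y z : Y) (u v w : seq Y).

(** The extra one makes [weight], the length of the block word, additive under merging. *)
Definition merge y z : Y := (y.1 + z.1, (y.2 + z.2).+1).
Definition weight u : nat := \sum_(y <- u) y.2.+1.
Definition total u : G := \sum_(y <- u) y.1.

Local Notation stm := (stuffle merge).

Lemma weight_cons y u : weight (y :: u) = (y.2.+1 + weight u)%N.
Proof. exact: big_cons. Qed.

Lemma weight_rcons y u : weight (rcons u y) = (weight u + y.2.+1)%N.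
Proof. exact: big_rcons. Qed.

Lemma total_cons y u : total (y :: u) = y.1 + total u.
Proof. exact: big_cons. Qed.

Lemma total_rcons y u : total (rcons u y) = total u + y.1.
Proof. exact: big_rcons. Qed.

(* K m u stands for C^*(u, v_0|m), where v_0 is determined by the condition that
   the product of all the v_i is 1, so that this is the vanishing of the second
   shuffles. *)
Definition doubly_shuffling (W : zmodType) (K : nat -> seq Y -> W) : Prop :=
  forall u v m, stm u v (K m) = K (m + weight v)%N u + K (m + weight u)%N v.

Section Reduced.
Variables (W : zmodType) (K : nat -> seq Y -> W).
Hypothesis K_nil : forall m, K m [::] = 0.

(** Expansion by first letters. A word of length one occurs only as [merge y z] with [u] and [v]
    empty, whence the separate hypothesis on it; the term to be subtracted there is [K] at the empty
    word, which vanishes. *)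
Lemma stuffle_reducedl y u z v m (F : seq Y -> W) :
  (forall x w, w != [::] -> F (x :: w) = K m (x :: w) - K (m + x.2).+1 w) ->
  (F [:: merge y z] = K m [:: merge y z]) ->
  stm (y :: u) (z :: v) F = stm (y :: u) (z :: v) (K m)
    - stm u (z :: v) (K (m + y.2).+1) - stm (y :: u) v (K (m + z.2).+1)
    + stm u v (K (m + (merge y z).2).+1).
Proof.
move=> F_cons F_merge; rewrite !stuffle_cons.
rewrite (@eq_stuffle_size _ _ _ u (z :: v) _
  (fun w => K m (y :: w) - K (m + y.2).+1 w)); last first.
  by move=> w _ vw; rewrite F_cons; case: w vw.
rewrite (@eq_stuffle_size _ _ _ (y :: u) v _
  (fun w => K m (z :: w) - K (m + z.2).+1 w)); last first.
  by move=> w uw _; rewrite F_cons; case: w uw.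
rewrite (@eq_stuffle_size _ _ _ u v (fun w => F (merge y z :: w))
  (fun w => K m (merge y z :: w) - K (m + (merge y z).2).+1 w)); last first.
  move=> [|x w] _ _; first by rewrite F_merge K_nil subr0.
  by rewrite F_cons.
by rewrite !stuffleB; abel.
Qed.

Lemma stuffle_reducedr y u z v m (F : seq Y -> W) :
  (forall x w, F (rcons w x) = K m (rcons w x) - K (m + x.2).+1 w) ->
  stm (rcons u y) (rcons v z) F = stm (rcons u y) (rcons v z) (K m)
    - stm u (rcons v z) (K (m + y.2).+1) - stm (rcons u y) v (K (m + z.2).+1)
    + stm u v (K (m + (merge y z).2).+1).
Proof.
move=> F_rcons; rewrite !stuffle_rcons.
have FE x : (fun w => F (rcons w x)) = fun w =>
  K m (rcons w x) - K (m + x.2).+1 w.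
  by apply/funext.
by rewrite !FE !stuffleB; abel.
Qed.

(** All terms of the relation except the first involve fewer letters, so a nested induction
    evaluates them, and the weights match so that all but two values cancel. The converse is
    [reduced_of_doubly_shuffling]. *)
Lemma doubly_shuffling_of_reduced :
  (forall y u z v m, stm (y :: u) (z :: v) (K m)
    - stm u (z :: v) (K (m + y.2).+1) - stm (y :: u) v (K (m + z.2).+1)
    + stm u v (K (m + (merge y z).2).+1) = 0) ->
  doubly_shuffling K.
Proof.
move=> K0; elim=> [|y u IHu] v m.
  by rewrite stuffle_nill K_nil add0r /weight big_nil addn0.
elim: v m => [|z v IHv] m.
  by rewrite stuffle_nilr K_nil addr0 /weight big_nil addn0.
have -> : stm (y :: u) (z :: v) (K m) = stm u (z :: v) (K (m + y.2).+1)
    + stm (y :: u) v (K (m + z.2).+1) - stm u v (K (m + (merge y z).2).+1).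
  by apply: subr0_eq; rewrite -[RHS](K0 y u z v m); abel.
rewrite !IHu IHv !weight_cons /merge /=.
have -> : ((m + y.2).+1 + (z.2.+1 + weight v)
  = (m + (y.2 + z.2).+1).+1 + weight v)%N by lia.
have -> : ((m + z.2).+1 + (y.2.+1 + weight u)
  = (m + (y.2 + z.2).+1).+1 + weight u)%N by lia.
have -> : ((m + y.2).+1 + weight u = m + (y.2.+1 + weight u))%N by lia.
have -> : ((m + z.2).+1 + weight v = m + (z.2.+1 + weight v))%N by lia.
by abel.
Qed.

Lemma reduced_of_doubly_shuffling y u z v m : doubly_shuffling K ->
  stm (y :: u) (z :: v) (K m)
    - stm u (z :: v) (K (m + y.2).+1) - stm (y :: u) v (K (m + z.2).+1)
    + stm u v (K (m + (merge y z).2).+1) = 0.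
Proof.
move=> KE; rewrite !KE !weight_cons /merge /=.
have -> : ((m + y.2).+1 + (z.2.+1 + weight v)
  = (m + (y.2 + z.2).+1).+1 + weight v)%N by lia.
have -> : ((m + z.2).+1 + (y.2.+1 + weight u)
  = (m + (y.2 + z.2).+1).+1 + weight u)%N by lia.
have -> : ((m + y.2).+1 + weight u = m + (y.2.+1 + weight u))%N by lia.
have -> : ((m + z.2).+1 + weight v = m + (z.2.+1 + weight v))%N by lia.
by abel.
Qed.

Lemma reducedr_of_doubly_shuffling y u z v m : doubly_shuffling K ->
  stm (rcons u y) (rcons v z) (K m)
    - stm u (rcons v z) (K (m + y.2).+1) - stm (rcons u y) v (K (m + z.2).+1)
    + stm u v (K (m + (merge y z).2).+1) = 0.
Proof.
move=> KE; rewrite !KE !weight_rcons /merge /=.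
have -> : ((m + y.2).+1 + (weight v + z.2.+1)
  = (m + (y.2 + z.2).+1).+1 + weight v)%N by lia.
have -> : ((m + z.2).+1 + (weight u + y.2.+1)
  = (m + (y.2 + z.2).+1).+1 + weight u)%N by lia.
have -> : ((m + y.2).+1 + weight u = m + (weight u + y.2.+1))%N by lia.
have -> : ((m + z.2).+1 + weight v = m + (weight v + z.2.+1))%N by lia.
by abel.
Qed.

End Reduced.

Section Cobracket.
Variables (V W : zmodType) (br : V -> V -> W).
Hypothesis brDl : forall a b c, br (a + b) c = br a c + br b c.
Hypothesis brDr : forall a b c, br a (b + c) = br a b + br a c.
Hypothesis br_alt : forall a, br a a = 0.

Lemma brC a b : br a b = - br b a.
Proof.
apply/eqP; rewrite -addr_eq0; apply/eqP.
by move: (br_alt (a + b)); rewrite brDl !brDr !br_alt add0r addr0.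
Qed.

Lemma br0l c : br 0 c = 0.
Proof. by apply: (addrI (br 0 c)); rewrite -brDl !addr0. Qed.

Lemma br0r c : br c 0 = 0.
Proof. by apply: (addrI (br c 0)); rewrite -brDr !addr0. Qed.

Lemma brNl a c : br (- a) c = - br a c.
Proof. by apply/eqP; rewrite -addr_eq0 -brDl addNr br0l. Qed.

Lemma brNr a c : br c (- a) = - br c a.
Proof. by apply/eqP; rewrite -addr_eq0 -brDr addNr br0r. Qed.

Lemma brBr a b c : br c (a - b) = br c a - br c b.
Proof. by rewrite brDr brNr. Qed.

Lemma brBl a b c : br (a - b) c = br a c - br b c.
Proof. by rewrite brDl brNl. Qed.

Lemma stuffle_brl (T : Type) (op : T -> T -> T) (u v : seq T) (H : seq T -> V)
  c :
  stuffle op u v (fun x => br (H x) c) = br (stuffle op u v H) c.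
Proof. by apply/esym/(@stuffle_exchange _ _ unit _ _ (fun h =>
  br (h tt) c) u v (fun=> H)) => h k; apply: brDl. Qed.

Lemma stuffle_brr (T : Type) (op : T -> T -> T) (u v : seq T) (H : seq T -> V)
  c :
  stuffle op u v (fun x => br c (H x)) = br c (stuffle op u v H).
Proof. by apply/esym/(@stuffle_exchange _ _ unit _ _ (fun h =>
  br c (h tt)) u v (fun=> H)) => h k; apply: brDr. Qed.

Variables (K : nat -> seq Y -> V) (l : G -> V).
Hypothesis K_nil : forall m, K m [::] = 0.
Hypothesis KE : doubly_shuffling K.
Hypothesis lD : forall a b, l (a + b) = l a + l b.

(* With K m u = c(1 u 0^m), where u stands for a block word, [reducedl m u] is
   c(1 u 0^m) - c(0 u 0^m); the last term comes from the scaling relation in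
   weight 1. If z is the last letter of u = u' z, then [reducedr m u] is
   c(0^m 1 u' z) - c(0^m 1 u' 0). *)
Definition reducedl m u : V :=
  if u is y :: u' then
    K m u - K (m + y.2).+1 u'
      - (if nilp u' && (m + y.2 == 0)%N then l y.1 else 0)
  else 0.

Definition reducedr m u : V :=
  onlast u (fun u' y => K m (rcons u' y) - K (m + y.2).+1 u').

Lemma reducedl_stuffle u v m : u != [::] -> v != [::] -> stm u v (reducedl m) =
  0.
Proof.
case: u v => [|y u] // [|z v] // _ _.
rewrite (@stuffle_reducedl _ K K_nil y u z v m);
  first exact: reduced_of_doubly_shuffling.
- by move=> x [|t w] // _; rewrite /= subr0.
- by rewrite /= K_nil addnS !subr0.
Qed.

Lemma reducedr_stuffle u v m : u != [::] -> v != [::] -> stm u v (reducedr m) =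
  0.
Proof.
case/lastP: u v => [|u y] // v _; case/lastP: v => [|v z] // _.
rewrite (@stuffle_reducedr _ K y u z v m);
  first exact: reducedr_of_doubly_shuffling.
by move=> x w; rewrite /reducedr onlast_rcons.
Qed.

(* tau1 and tau2 come from the factors P in a z P b, resp. a P z b,
  and tau0 from
   those which consist of the single letter 0, where scaling fails. *)
Definition tau0 (p : seq Y) (k : Y -> V) : W :=
  if p is [:: y] then if y.2 is n.+1 then br (k (y.1, n)) (l y.1) else 0 else 0.

Definition tau1 (p : seq Y) (k : Y -> V) : W := onlast p (fun q y =>
  \sum_(i < y.2.+1) br (k (y.1 + total q, i : nat)) (reducedl (y.2 - i) q)).

Definition tau2 (p : seq Y) (k : Y -> V) : W := if p is y :: q then
  \sum_(i < y.2.+1) br (k (y.1 + total q, i : nat)) (reducedr (y.2 - i) q) else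
    0.

Definition tau p k : W := tau0 p k - tau1 p k + tau2 p k.

Lemma tau_additive p : additive_functional (tau p).
Proof.
move=> h k; rewrite /tau.
have -> : tau0 p (fun i => h i + k i) = tau0 p h + tau0 p k.
  by rewrite /tau0; case: p => [|[a [|n]] []]; rewrite ?addr0 //= brDl.
have -> : tau1 p (fun i => h i + k i) = tau1 p h + tau1 p k.
  rewrite /tau1; case/lastP: p => [|q y]; first by rewrite /= addr0.
  by rewrite !onlast_rcons -big_split; apply: eq_bigr => i _; rewrite brDl.
have -> : tau2 p (fun i => h i + k i) = tau2 p h + tau2 p k.
  rewrite /tau2; case: p => [|q y]; first by rewrite addr0.
  by rewrite -big_split; apply: eq_bigr => i _; rewrite brDl.
by abel.
Qed.

Lemma stuffleC u v (H : seq Y -> W) : stm u v H = stm v u H.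
Proof.
rewrite stuffle_flip; congr (stuffle _ v u H); apply/funext => y;
  apply/funext => z.
by rewrite /merge addrC addnC.
Qed.

Lemma stuffle_total a n u v (k : Y -> V) (F : 'I_n -> seq Y -> V) :
  stm u v (fun q => \sum_(i < n) br (k (a + total q, i : nat)) (F i q))
  = \sum_(i < n) br (k (a + (total u + total v), i : nat)) (stm u v (F i)).
Proof.
rewrite stuffle_sum; apply: eq_bigr => i _; rewrite -stuffle_brr.
by apply: (@eq_stuffle _ _ _ _ (fun y : Y => y.1)) => // q _ _ tq;
  rewrite [total q]tq.
Qed.

Lemma stuffle_total0 a n u v (k : Y -> V) (F : 'I_n -> seq Y -> V) :
  (forall i, stm u v (F i) = 0) ->
  stm u v (fun q => \sum_(i < n) br (k (a + total q, i : nat)) (F i q)) = 0.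
Proof. by move=> F0; rewrite stuffle_total big1 // => i _; rewrite F0 br0r. Qed.

Lemma tau0_stuffle u v k : (1 < size u)%N || (1 < size v)%N ->
  stm u v (fun p => tau0 p k) = 0.
Proof.
move=> uv; rewrite -[RHS](stuffle0 merge W u v);
  apply: eq_stuffle_size => p up vp.
by case: p up vp => [|y [|z p]] //=; case: u v uv => [|? [|? ?]] [|? [|? ?]].
Qed.

(** A merged letter carries [m + n + 1] zeros, hence [m + n + 2] cut positions; they are split into
    those of its first constituent and those of its second. *)
Lemma sum_merge (w : G) (m n : nat) (k : Y -> V) (F : nat -> V) :
  \sum_(i < (m + n).+2) br (k (w, i : nat)) (F ((m + n).+1 - i)%N)
  = \sum_(i < m.+1) br (k (w, i : nat)) (F (m - i + n.+1)%N)
    + \sum_(i < n.+1) br (k (w, (m + i).+1)) (F (n - i)%N).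
Proof.
rewrite (_ : (m + n).+2 = (m.+1 + n.+1)%N); last by lia.
rewrite big_split_ord /=; congr (_ + _); apply: eq_bigr => i _ /=.
  by congr (br _ (F _)); move: (ltn_ord i); lia.
by congr (br (k (w, _)) (F _)); move: (ltn_ord i); lia.
Qed.

Lemma tau1_rcons z k : (fun p => tau1 (rcons p z) k) = fun p =>
  \sum_(i < z.2.+1) br (k (z.1 + total p, i : nat)) (reducedl (z.2 - i) p).
Proof. by apply/funext => p; rewrite /tau1 onlast_rcons. Qed.

(** As [tau1] singles out the last letter, expansion by last letters leaves [reducedl] on products
    of nonempty words, which vanishes. For [tau2], first letters and [reducedr] take over. *)
Lemma tau1_stuffle2 u y v z k : u != [::] -> v != [::] ->
  stm (rcons u y) (rcons v z) (fun p => tau1 p k) = 0.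
Proof.
move=> u0 v0; have n0 w t : rcons w t != [::] :> seq Y by case: w.
rewrite stuffle_rcons !tau1_rcons !stuffle_total0 ?subr0 ?addr0 // => i;
  exact: reducedl_stuffle.
Qed.

Lemma tau2_stuffle2 u y v z k : u != [::] -> v != [::] ->
  stm (y :: u) (z :: v) (fun p => tau2 p k) = 0.
Proof.
move=> u0 v0.
rewrite stuffle_cons /tau2 !stuffle_total0 ?subr0 ?addr0 // => i;
  exact: reducedr_stuffle.
Qed.

(** If [z] comes last, a product of nonempty words remains and contributes 0. If [y] and [z] merge,
    [sum_merge] splits the sum: one half cancels the second summand on the left, the other is the
    subtracted term on the right. *)
Lemma tau1_stuffle1 y u z k : u != [::] ->
  stm [:: y] (rcons u z) (fun p => tau1 p k)
    + tau1 (rcons u z) (fun t => k (merge y t))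
  = \sum_(i < y.2.+1) br (k (y.1 + total (rcons u z), i : nat))
      (reducedl (y.2 - i) (rcons u z) - reducedl (y.2 - i + z.2.+1) u).
Proof.
move=> u0; rewrite -[[:: y]]/(rcons [::] y) stuffle_rcons !tau1_rcons /=.
rewrite [X in _ + X - _]stuffle_total0 => [|i]; last exact: reducedl_stuffle.
rewrite !stuffle_nill /tau1 onlast_rcons addr0 /merge /=.
rewrite (@sum_merge _ _ _ _ (reducedl ^~ u)).
have -> : y.1 + z.1 + total u = y.1 + total (rcons u z).
  by rewrite total_rcons [total u + _]addrC addrA.
under [in RHS]eq_bigr => i _ do rewrite brBr.
by rewrite sumrB total_rcons [total u + _]addrC /=; abel.
Qed.

Lemma tau2_stuffle1 y z u k : u != [::] ->
  stm [:: y] (z :: u) (fun p => tau2 p k) + tau2 (z :: u) (fun t =>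
    k (merge y t))
  = \sum_(i < y.2.+1) br (k (y.1 + total (z :: u), i : nat))
      (reducedr (y.2 - i) (z :: u) - reducedr (y.2 - i + z.2.+1) u).
Proof.
move=> u0; rewrite stuffle_cons /tau2.
rewrite [X in _ + X - _]stuffle_total0 => [|i]; last exact: reducedr_stuffle.
rewrite !stuffle_nill addr0 /merge /=.
rewrite (@sum_merge _ _ _ _ (reducedr ^~ u)) !total_cons !addrA.
under [in RHS]eq_bigr => i _ do rewrite brBr.
rewrite sumrB. abel.
Qed.

(** Both sides are the same second difference of [K], in which [z] and [t] are turned into zeros
    independently. This is where cyclic invariance enters, through the use of one [K] for both
    reductions. *)
Lemma reducedl_reducedr z u t m :
  reducedl m (z :: rcons u t) - reducedl (m + t.2.+1) (z :: u)
  = reducedr m (z :: rcons u t) - reducedr (m + z.2.+1) (rcons u t).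
Proof.
rewrite -rcons_cons /reducedr !onlast_rcons /reducedl rcons_cons.
rewrite (_ : nilp (rcons u t) = false); last by case: u.
rewrite (_ : (m + t.2.+1 + z.2 == 0)%N = false); last by lia.
have -> : (m + t.2.+1 + z.2 = m + z.2.+1 + t.2)%N by lia.
by rewrite andbF (addnS m t.2) (addnS m z.2) /=; abel.
Qed.

(** The defects of [tau1] and [tau2] agree by [reducedl_reducedr] and cancel in [tau]. *)
Lemma tau_stuffle1 y v k : (1 < size v)%N ->
  stm [:: y] v (fun p => tau p k) = - tau v (fun z => k (merge y z)).
Proof.
case: v => [|z v] //; case/lastP: v => [|v t] // _.
rewrite /tau stuffleD stuffleB tau0_stuffle; last by rewrite /= size_rcons.
have v0 : rcons v t != [::] by case: v.
have := @tau1_stuffle1 y (z :: v) t k isT; have := @tau2_stuffle1 y z _ k v0.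
move=> /(canRL (addrK _)) -> /(canRL (addrK _)) ->.
rewrite (_ : tau0 (z :: _) _ = 0); last by case: (v).
rewrite -[rcons (z :: v) t]/(z :: rcons v t).
under eq_bigr => i _ do rewrite reducedl_reducedr.
by abel.
Qed.

(** The two reductions of [[:: z]] agree except in weight 1, so only the top index [y.2] can leave a
    logarithm. *)
Lemma tau_stuffle11 y z k :
  tau2 [:: y; z] k - tau1 [:: z; y] k
  = if z.2 is 0 then br (k (y.1 + z.1, y.2)) (l z.1) else 0.
Proof.
rewrite /tau2 /tau1 /= -sumrB /total !big_seq1 big_ord_recr big1 => [|i _] /=.
  rewrite add0r -brBr /reducedr /reducedl /= subnn K_nil /= add0n.
  by case: z.2 => [|n]; rewrite -?[RHS](br0r (k (y.1 + z.1, y.2)));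
    congr (br _ _) => /=; abel.
rewrite -brBr -[RHS](br0r (k (y.1 + z.1, i : nat))); congr (br _ _).
rewrite /reducedr /reducedl /= K_nil (_ : (y.2 - i + z.2 == 0)%N = false);
  first by abel.
by move: (ltn_ord i); lia.
Qed.

Lemma tau_nil k : tau [::] k = 0.
Proof. by rewrite /tau /tau0 /tau1 /tau2 /= subrr addr0. Qed.

Lemma tau_seq1 y k : tau [:: y] k = tau0 [:: y] k.
Proof.
rewrite /tau /tau1 /tau2 /onlast /= [X in _ - X]big1 => [|i _];
  last exact: br0r.
by rewrite big1 => [|i _]; [rewrite subr0 addr0 | rewrite br0r].
Qed.

Lemma tau_stuffle u v k : stm u v (fun p => tau p k) =
  (if u is [::] then tau v k else 0) + (if v is [::] then tau u k else 0)
  - (if u is [:: y] then tau v (fun z => k (merge y z)) else 0)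
  - (if v is [:: z] then tau u (fun y => k (merge y z)) else 0).
Proof.
have mC y z : merge y z = merge z y by rewrite /merge addrC addnC.
case: u v => [|y u] v.
  by rewrite stuffle_nill; case: v => [|z [|t v]]; rewrite ?tau_nil; abel.
case: v => [|z v]; first by rewrite stuffle_nilr; case: u => [|t u];
  rewrite ?tau_nil; abel.
case: u v => [|y' u] [|z' v].
- rewrite stuffle_cons stuffle_nilr !stuffle_nill !tau_seq1 /tau
  !(tau0_stuffle, subr0, sub0r).
  (* The logarithms left by [tau1] and [tau2] supply the terms that [tau0] lacks at letters without
     zeros; their sum is [tau0] at the merged letter because [l] is additive. *)
  have := tau_stuffle11 y z k; have := tau_stuffle11 z y k.
  move=> /(canRL (subrK _)) -> /(canRL (subrK _)) ->.
  rewrite /tau0 /merge /= lD brDr [z.1 + y.1]addrC.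
  by case: y.2 z.2 => [|n] [|m]; rewrite ?addn0 ?addnS ?addSn; abel.
- by rewrite tau_stuffle1 //; abel.
- rewrite stuffleC tau_stuffle1 //.
  rewrite (_ : (fun t => k (merge z t)) = fun t => k (merge t z));
    first by abel.
  by apply/funext => t; rewrite mC.
- rewrite /tau stuffleD stuffleB tau0_stuffle // tau2_stuffle2 // lastI [z ::
  _]lastI tau1_stuffle2 //.
  by abel.
Qed.

(** The closed form that [cobracket_yword] finds for the cobracket of [reducedl m u]; the second
    term also distributes the [m] final zeros over the two parts. *)
Definition cobracket m u : W :=
  substitute tau u (reducedl m)
  - cut u (fun a b => \sum_(i < m.+1) br (reducedl i a) (reducedl (m - i) b))
  - (if m is m'.+1 then br (reducedl m' u) (l (total u)) else 0).

(** The first term vanishes since substitution is a derivation, the last since [total] is constant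
    on the words of the product, and the middle one since it reduces to an antisymmetric expression
    in [u] and [v]. *)
Lemma cobracket_stuffle u v m : u != [::] -> v != [::] -> stm u v (cobracket m)
  = 0.
Proof.
move=> u0 v0; rewrite /cobracket !stuffleB.
rewrite substitute_derivation; [|exact: tau_additive|exact: tau_stuffle].
have sub0 (t : seq Y) (H : seq Y -> V) : (forall w, w != [::] -> H w = 0) ->
    substitute tau t H = 0.
  move=> H0; rewrite -[RHS](cut0 W t); apply: eq_cut => a r _.
  rewrite -[RHS](cut0 W r); apply: eq_cut => p b _.
  rewrite (_ : (fun y => _) = fun=> 0).
    exact: functional0 (tau_additive p).
  by apply/funext => y; apply: H0; case: a.
rewrite !sub0; first 1 last.
- by move=> w w0; apply: reducedl_stuffle.
- by move=> w w0; apply: reducedl_stuffle.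
rewrite addr0 sub0r [X in _ - X = 0](_ : _ = 0) ?subr0; last first.
  case: m => [|m]; first exact: stuffle0.
  rewrite (@eq_stuffle _ _ _ _ (fun y : Y => y.1) u v _
    (fun w => br (reducedl m w) (l (total u + total v)))) //; last first.
    by move=> w _ _ tw; rewrite [total w]tw.
  by rewrite stuffle_brl reducedl_stuffle // br0l.
apply/eqP; rewrite oppr_eq0; apply/eqP; rewrite stuffle_cut.
pose conv a b := \sum_(i < m.+1) br (reducedl i a) (reducedl (m - i) b).
have convC a b : conv a b = - conv b a.
  rewrite /conv -sumrN (reindex_inj rev_ord_inj); apply: eq_bigr => i _ /=.
  by rewrite brC subSS subKn // -ltnS.
(* Any other pair of cuts leaves two nonempty words to be multiplied in one of the two factors,
   where [reducedl_stuffle] applies. *)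
rewrite (_ : cut u _ = cut u (fun u1 u2 => cut v (fun v1 v2 =>
  (if u1 is [::] then if v2 is [::] then conv v1 u2 else 0 else 0)
  + (if u2 is [::] then if v1 is [::] then conv u1 v2 else 0 else 0)))).
  under eq_cut => u1 u2 _ do rewrite cutD.
  rewrite cutD.
  under [X in X + _]eq_cut => u1 u2 _.
    rewrite (_ : cut v _ = if u1 is [::] then conv v u2 else 0); last first.
      by case: u1 => [|? ?]; [exact: cut_nilr (fun a =>
        conv a u2) | exact: cut0].
    over.
  rewrite cut_nil.
  under [X in _ + X]eq_cut => u1 u2 _.
    rewrite (_ : cut v _ = if u2 is [::] then conv u1 v else 0); last first.
      by case: u2 => [|? ?]; [exact: cut_nil | exact: cut0].
    over.
  by rewrite cut_nilr convC addNr.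
apply: eq_cut => u1 u2 uE; apply: eq_cut => v1 v2 vE.
rewrite (_ : stm u1 v1 _ =
  \sum_(i < m.+1) br (stm u1 v1 (reducedl i)) (stm u2 v2 (reducedl (m - i))));
    last first.
  under eq_stuffle_size => a _ _ do rewrite stuffle_sum.
  rewrite stuffle_sum; apply: eq_bigr => i _.
  by under eq_stuffle_size => a _ _ do rewrite stuffle_brr; rewrite stuffle_brl.
rewrite /conv.
by case: u1 u2 v1 v2 uE vE => [|x u1] [|y u2] [|z v1] [|t v2] uE vE;
  first [by rewrite -uE in u0 | by rewrite -vE in v0 | by rewrite ?(addr0,
    add0r)
  | by rewrite addr0 big1 // => i _; first
    [ rewrite [X in br X _]reducedl_stuffle // br0l
    | rewrite [X in br _ X]reducedl_stuffle // br0r ] ].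
Qed.

End Cobracket.
End Core.
(** * Cobrackets of necklaces *)

Lemma rot_invariant_cat (T S : Type) (c : seq T -> S) :
  (forall s, c (rot 1 s) = c s) -> forall s t, c (s ++ t) = c (t ++ s).
Proof.
move=> c_rot; elim=> [|x s IHs] t; first by rewrite cats0.
by rewrite -c_rot /= rot1_cons -cats1 -catA IHs -catA.
Qed.

Section NecklaceCobracket.
Variables (T : Type) (V W : zmodType) (br : V -> V -> W).
Hypothesis brDl : forall a b c, br (a + b) c = br a c + br b c.
Hypothesis brDr : forall a b c, br a (b + c) = br a b + br a c.
Hypothesis br_alt : forall a, br a a = 0.
Variable c : seq T -> V.
Hypothesis c_rot : forall s, c (rot 1 s) = c s.

(** Unlike in [cuts], empty [p] and [q] are allowed; these terms vanish once [c] kills words of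
    length one. *)
Definition necklace_cobracket (s : seq T) : W :=
  mark s (fun a z b => cut (b ++ a) (fun p q => br (c (z :: p)) (c (z :: q)))).

(** The cutting letter is [x] or a letter [z] of [u]. In the second case exactly one of the two
    pieces contains [x]; that piece is rotated to begin with [x]. *)
Lemma necklace_cobracket_cons x u :
  necklace_cobracket (x :: u) =
    cut u (fun p q => br (c (x :: p)) (c (x :: q)))
    - mark u (fun a z b => cut b (fun p b' =>
        br (c (x :: a ++ z :: b')) (c (z :: p))))
    + mark u (fun a z b => cut a (fun a' p =>
        br (c (x :: a' ++ z :: b)) (c (z :: p)))).
Proof.
rewrite /necklace_cobracket mark_cons cats0 -addrA -markN -markD; congr (_ + _).
apply: eq_mark => a z b _; rewrite cut_cat_cons -cutN.
congr (_ + _); apply: eq_cut => p q _.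
  rewrite (brC brDl brDr br_alt); congr (- br _ _).
  exact: (rot_invariant_cat c_rot (z :: q) (x :: a)).
congr (br _ _); exact: (rot_invariant_cat c_rot (z :: b) (x :: p)).
Qed.

Variable o : T.

Definition gauged (z : T) (p : seq T) : V := c (z :: p) - c (o :: p).

(* Subtracting the value at [o] amounts to composing with the inner derivation
   that annihilates [o]: all the terms in which [o] is the cutting letter
   telescope. *)
Lemma gauged_cobracket x u :
  necklace_cobracket (x :: u) - necklace_cobracket (o :: u) =
    cut u (fun p q => br (gauged x p) (gauged x q))
    - mark u (fun a z b => cut b (fun p b' =>
        br (gauged x (a ++ z :: b')) (gauged z p)))
    + mark u (fun a z b => cut a (fun a' p =>
        br (gauged x (a' ++ z :: b)) (gauged z p))).
Proof.
have cE z p : c (z :: p) = gauged z p + c (o :: p) by rewrite subrK.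
(* [X] carries the terms in which a piece [p] is closed up by [o]. Each of [X1] and [X2] is the sum
   over all triple cuts minus a boundary sum; the full sums cancel each other and the boundary sums
   cancel those of [M0]. *)
pose X a p b := br (gauged x (a ++ b)) (c (o :: p)).
have X1 : mark u (fun a z b => cut b (fun p b' => X (rcons a z) p b'))
    = cut u (fun a r => cut r (fun p b => X a p b)) - cut u (X [::]).
  by rewrite cut_mark addrC addKr.
have X2 : mark u (fun a z b => cut a (fun a' p => X a' p (z :: b)))
    = cut u (fun a r => cut r (fun p b => X a p b)) - cut u (fun a p =>
      X a p [::]).
  by rewrite -cutA cut_mark_last addrK.
have M1 : mark u (fun a z b => cut b (fun p b' =>
      br (c (x :: a ++ z :: b')) (c (z :: p)))) -
    mark u (fun a z b => cut b (fun p b' =>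
      br (c (o :: a ++ z :: b')) (c (z :: p)))) =
    mark u (fun a z b => cut b (fun p b' =>
      br (gauged x (a ++ z :: b')) (gauged z p))) +
    mark u (fun a z b => cut b (fun p b' => X (rcons a z) p b')).
  rewrite -markN -!markD; apply: eq_mark => a z b _.
  rewrite -cutN -!cutD; apply: eq_cut => p b' _.
  by rewrite /X cat_rcons -(brBl brDl) -brDr -cE.
have M2 : mark u (fun a z b => cut a (fun a' p =>
      br (c (x :: a' ++ z :: b)) (c (z :: p)))) -
    mark u (fun a z b => cut a (fun a' p =>
      br (c (o :: a' ++ z :: b)) (c (z :: p)))) =
    mark u (fun a z b => cut a (fun a' p =>
      br (gauged x (a' ++ z :: b)) (gauged z p))) +
    mark u (fun a z b => cut a (fun a' p => X a' p (z :: b))).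
  rewrite -markN -!markD; apply: eq_mark => a z b _.
  rewrite -cutN -!cutD; apply: eq_cut => p b' _.
  by rewrite /X -(brBl brDl) -brDr -cE.
have M0 : cut u (fun p q => br (c (x :: p)) (c (x :: q))) -
    cut u (fun p q => br (c (o :: p)) (c (o :: q))) =
    cut u (fun p q => br (gauged x p) (gauged x q)) +
    (cut u (fun a p => X a p [::]) - cut u (X [::])).
  rewrite -!cutN -!cutD; apply: eq_cut => p q _.
  rewrite /X cats0 /= !(cE x); move: (gauged x p) (gauged x q) => f g.
  by rewrite !brDl !brDr [br (c _) g](brC brDl brDr br_alt); abel.
rewrite !necklace_cobracket_cons.
move: M0 M1 M2; rewrite X1 X2.
move=> /(canRL (subrK _)) -> /(canRL (subrK _)) -> /(canRL (subrK _)) ->.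
by abel.
Qed.

End NecklaceCobracket.
(** * Block words *)

Section Words.
Variable G : zmodType.
Local Notation Y := (G * nat)%type.
Implicit Types (g : G) (y : Y) (u : seq Y) (m n : nat).

Local Notation zeros n := (nseq n (None : letter G)).

(* The blocks 0^{m_1}, v_1, 0^{m_2}, v_1 v_2, ... of C^*, where each letter is
   determined by its ratio to the preceding letter, starting from g. *)
Fixpoint yword g u : word G :=
  if u is y :: u' then zeros y.2 ++ Some (g + y.1) :: yword (g + y.1) u'
  else [::].

Lemma yword_cat g u v : yword g (u ++ v) = yword g u ++ yword (g + total u) v.
Proof.
elim: u g => [|y u IHu] g /=; first by rewrite /total big_nil addr0.
by rewrite IHu total_cons addrA -catA.
Qed.

Lemma yword_rcons g u y : yword g (rcons u y)
  = yword g u ++ zeros y.2 ++ [:: Some (g + total u + y.1)].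
Proof. by rewrite -cats1 yword_cat. Qed.

Lemma map_lscale_yword a g u : map (lscale a) (yword g u) = yword (a + g) u.
Proof.
by elim: u g => //= y u IHu g; rewrite map_cat map_nseq /= IHu addrA.
Qed.

Lemma size_yword g u : size (yword g u) = weight u.
Proof.
elim: u g => [|y u IHu] g; first by rewrite /weight big_nil.
by rewrite size_cat size_nseq /= IHu weight_cons addnS.
Qed.

Lemma zeros_cat n m : zeros n ++ zeros m = zeros (n + m).
Proof. by rewrite nseqD. Qed.

Section CutWords.
Variable W : zmodType.

Lemma mark_nseq n s (h : word G -> letter G -> word G -> W) :
  (forall a b, h a None b = 0) ->
  mark (zeros n ++ s) h = mark s (fun a => h (zeros n ++ a)).
Proof.
move=> h0; elim: n h h0 => [|n IHn] h h0 //=.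
by rewrite mark_cons h0 add0r IHn.
Qed.

Lemma mark_yword g u m (h : word G -> letter G -> word G -> W) :
  (forall a b, h a None b = 0) ->
  mark (yword g u ++ zeros m) h =
  mark u (fun a y b => h (yword g a ++ zeros y.2) (Some (g + total a + y.1))
                         (yword (g + total a + y.1) b ++ zeros m)).
Proof.
elim: u g h => [|y u IHu] g h h0.
  by rewrite -[yword g [::] ++ _]cats0 mark_nseq // /mark /=.
rewrite /= -catA mark_nseq // /= !mark_cons IHu //; congr (_ + _).
  by rewrite /= cats0 /total big_nil addr0.
apply: eq_mark => a z b _ /=.
by rewrite total_cons addrA -catA.
Qed.

Lemma cut_nseq n s (h : word G -> word G -> W) :
  cut (zeros n ++ s) h = \sum_(i < n) h (zeros i) (zeros (n - i) ++ s)
    + cut s (fun a b => h (zeros n ++ a) b).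
Proof.
elim: n h => [|n IHn] h; first by rewrite big_ord0 add0r.
by rewrite /= IHn big_ord_recl addrA.
Qed.

(** A cut falls before the nonzero letter of some block, after [i] of its zeros, or among the final
    zeros. A cut just after a nonzero letter counts as position 0 of what follows. *)
Lemma cut_yword g u m (h : word G -> word G -> W) :
  cut (yword g u ++ zeros m) h =
  mark u (fun a y b => \sum_(i < y.2.+1)
     h (yword g a ++ zeros i)
       (zeros (y.2 - i) ++ Some (g + total a + y.1)
          :: yword (g + total a + y.1) b ++ zeros m))
  + \sum_(i < m.+1) h (yword g u ++ zeros i) (zeros (m - i)).
Proof.
elim: u g h => [|y u IHu] g h.
  rewrite /mark /= add0r -[zeros m]cats0 cut_nseq /= big_ord_recr /= subnn
    cats0.
  by congr (_ + _); apply: eq_bigr => i _; rewrite cats0.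
rewrite /= -catA cut_nseq /= IHu mark_cons [X in _ = X + _ + _]big_ord_recr /=
  subnn.
rewrite /total big_nil addr0 cats0 -!addrA; congr (_ + (_ + _)).
congr (_ + _); last by apply: eq_bigr => i _; rewrite -catA.
apply: eq_mark => a z b _; apply: eq_bigr => i _.
by rewrite big_cons addrA -catA.
Qed.

End CutWords.

(** Rotate the initial zeros to the end, where they join the final ones, and rescale so that the
    first nonzero letter becomes the unit. *)
Lemma first_block_cyclic (S : Type) (c : word G -> S) y u m :
  (forall s, c (rot 1 s) = c s) ->
  (forall a s, (2 < size s)%N -> c (map (lscale a) s) = c s) ->
  (1 < size (yword 0 (y :: u) ++ zeros m))%N ->
  c (None :: yword 0 (y :: u) ++ zeros m)
  = c (Some 0 :: yword 0 u ++ zeros (m + y.2).+1).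
Proof.
move=> c_rot c_scale sz.
rewrite /= -catA (rot_invariant_cat c_rot (zeros y.2.+1)) cat_cons -catA
  zeros_cat.
rewrite add0r addnS -(c_scale (- y.1)).
  by rewrite map_cons map_cat map_nseq map_lscale_yword /= addNr.
by move: sz; rewrite /=; do 4 rewrite /= ?(size_cat, size_nseq, size_yword);
  lia.
Qed.

Section ScalingWords.
Variables (V : zmodType) (c : word G -> V).
Hypothesis c_short : forall s, (size s < 2)%N -> c s = 0.
Hypothesis c_rot : forall s, c (rot 1 s) = c s.
Hypothesis c_scale : forall a s, (2 < size s)%N -> c (map (lscale a) s) = c s.
Hypothesis c_zeros : forall n, c (zeros n) = 0.
Hypothesis c_one_zeros : forall n, c (Some 0 :: zeros n) = 0.

Let l g := c [:: None; Some g].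
Hypothesis c_scale2 : forall a (x z : letter G), ~ (x = None /\ z = None) ->
  c [:: lscale a x; lscale a z] = l a + c [:: x; z].

Definition cyclic_value m u : V := c (Some 0 :: yword 0 u ++ zeros m).

Lemma cyclic_value_nil m : cyclic_value m [::] = 0.
Proof. exact: c_one_zeros. Qed.

Lemma log_additive a b : l (a + b) = l a + l b.
Proof.
have := @c_scale2 a (Some b) None; rewrite /= => /(_ _); rewrite /l.
by rewrite -[c [:: Some (a + b); _]]c_rot -[c [:: Some b; _]]c_rot /=;
  apply; case.
Qed.

Lemma log0 : l 0 = 0.
Proof. by apply: (addrI (l 0)); rewrite -log_additive !addr0. Qed.

Local Notation gauged := (gauged c None).

(** The letter 0 is fixed by scaling, so in weight 1 both terms of the difference acquire the same
    [l a]. The exception is [[:: None]], where the second term is c(0,0) and acquires nothing. *)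
Lemma gauged_scale a g p : p <> [:: None] ->
  gauged (Some (a + g)) (map (lscale a) p) = gauged (Some g) p.
Proof.
rewrite /gauged; case: p => [|x [|y p]] p0.
- by rewrite !c_short.
- rewrite /= (@c_scale2 a (Some g) x) ?(@c_scale2 a None x); try by case.
    by rewrite opprD addrACA subrr add0r.
  by case=> _ x0; apply: p0; rewrite x0.
- by rewrite -(@c_scale a [:: Some g, x, y & p]) // -(@c_scale a [:: None, x,
  y & p]).
Qed.

Lemma gauged_zeros g n :
  gauged (Some g) (zeros n) = if n == 1%N then l g else 0.
Proof.
rewrite /gauged (c_zeros n.+1) subr0; case: n => [|[|n]].
- by rewrite c_short.
- by rewrite -c_rot.
- rewrite -(c_scale (- g)) ?size_nseq //= addNr !map_nseq.
  exact: (c_one_zeros n.+2).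
Qed.

Lemma gauged_none p : gauged None p = 0. Proof. exact: subrr. Qed.

Lemma gauged_yword m u :
  gauged (Some 0) (yword 0 u ++ zeros m) = reducedl cyclic_value l m u.
Proof.
case: u => [|y u]; first by rewrite /= gauged_zeros log0 if_same.
rewrite /gauged /reducedl /cyclic_value -addrA; congr (_ + _).
rewrite -opprD; congr (- _).
(* The exceptional word is the pair [None], [Some y.1], too short to be rescaled freely; its value
   [l y.1] is the correction in [reducedl]. *)
have [|my] := boolP (nilp u && (m + y.2 == 0)%N).
  rewrite addn_eq0 => /andP[/nilP -> /andP[/eqP -> /eqP y0]].
  by rewrite /= y0 (c_one_zeros 1) !add0r.
rewrite addr0 (first_block_cyclic c_rot c_scale) // size_cat size_yword
  size_nseq.
move: my; rewrite weight_cons; case: u => [|z u] /=.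
  by rewrite /weight big_nil; lia.
by rewrite weight_cons; lia.
Qed.

Lemma gauged_yword_from g m u :
  gauged (Some g) (yword g u ++ zeros m)
  = reducedl cyclic_value l m u + (if nilp u && (m == 1%N) then l g else 0).
Proof.
case: u => [|y u]; first by rewrite /= add0r gauged_zeros.
rewrite addr0 -gauged_yword -(@gauged_scale (- g) g).
  by rewrite addNr map_cat map_nseq map_lscale_yword addNr.
by move: y => [a [|[|n]]].
Qed.

(** Read from the letter [g], the necklace has its varying letter at the end of the last block,
    hence the mirror difference. *)
Lemma gauged_yword_last g j a y :
  gauged (Some (g + total a + y.1))
    (zeros j ++ Some g :: yword g a ++ zeros y.2)
  = reducedr cyclic_value j (rcons a y).
Proof.
have -> : zeros j ++ Some g :: yword g a ++ zeros y.2
    = map (lscale g) (zeros j ++ Some 0 :: yword 0 a ++ zeros y.2).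
  by rewrite !map_cat /= map_cat !map_nseq map_lscale_yword addr0.
rewrite -addrA gauged_scale; last by case: j => [|[|j]].
rewrite /reducedr onlast_rcons.
rewrite /gauged /cyclic_value yword_rcons -!catA; congr (_ - _).
  rewrite -(rot_invariant_cat c_rot (Some 0 :: yword 0 a ++ zeros y.2)
    (Some (total a + y.1) :: zeros j)) /= -!catA /=.
  by rewrite add0r.
rewrite -[None :: _]/(zeros j.+1 ++ _) (rot_invariant_cat c_rot) /= -catA.
by rewrite -[None :: _]/(zeros j.+1) zeros_cat addnC addSn.
Qed.

End ScalingWords.
End Words.

(** * Evaluation of the cobracket on block words *)

Section CobracketWords.
Variable G : zmodType.
Local Notation Y := (G * nat)%type.
Implicit Types (g : G) (y : Y) (u : seq Y) (m n : nat).
Local Notation zeros n := (nseq n (None : letter G)).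

Variables (V W : zmodType) (br : V -> V -> W).
Hypothesis brDl : forall a b c, br (a + b) c = br a c + br b c.
Hypothesis brDr : forall a b c, br a (b + c) = br a b + br a c.
Hypothesis br_alt : forall a, br a a = 0.

Variable c : word G -> V.
Hypothesis c_short : forall s, (size s < 2)%N -> c s = 0.
Hypothesis c_rot : forall s, c (rot 1 s) = c s.
Hypothesis c_scale : forall a s, (2 < size s)%N -> c (map (lscale a) s) = c s.
Hypothesis c_zeros : forall n, c (zeros n) = 0.
Hypothesis c_one_zeros : forall n, c (Some 0 :: zeros n) = 0.

Let l g := c [:: None; Some g].
Hypothesis c_scale2 : forall a (x z : letter G), ~ (x = None /\ z = None) ->
  c [:: lscale a x; lscale a z] = l a + c [:: x; z].

Local Notation K := (cyclic_value c).
Local Notation F := (reducedl K l).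
Local Notation f := (gauged c None (Some 0)).

Lemma sum_eq1 n (h : nat -> W) :
  \sum_(i < n.+1) (if i == 1%N :> nat then h i else 0)
  = if n is _.+1 then h 1%N else 0.
Proof.
rewrite big_ord_recl /= add0r; case: n => [|n]; first by rewrite big_ord0.
by rewrite big_ord_recl /= big1 ?addr0.
Qed.

Lemma sum_eq1_rev n (h : nat -> W) :
  \sum_(i < n.+1) (if (n - i == 1)%N then h i else 0)
  = if n is n'.+1 then h n' else 0.
Proof.
rewrite (reindex_inj rev_ord_inj) /=.
under eq_bigr => i _ do rewrite subSS subKn -1?ltnS //.
rewrite (sum_eq1 n (fun i => h (n - i)%N)).
by case: n => // n; rewrite subn1.
Qed.

Lemma sum_rev n (h : nat -> nat -> W) :
  \sum_(i < n.+1) h i (n - i)%N = \sum_(i < n.+1) h (n - i)%N i.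
Proof.
rewrite (reindex_inj rev_ord_inj); apply: eq_bigr => i _ /=.
by rewrite subSS subKn // -ltnS.
Qed.

Lemma substitute_tauE m u :
  substitute (tau br K l) u (F m) =
    mark u (fun a y b =>
      if y.2 is n.+1 then br (F m (a ++ (y.1, n) :: b)) (l y.1) else 0)
    - cut u (fun a r => mark r (fun b1 y b3 => \sum_(i < y.2.+1)
        br (F m (a ++ (y.1 + total b1, i : nat) :: b3)) (F (y.2 - i) b1)))
    + mark u (fun a y b => mark a (fun a1 z a2 => \sum_(i < z.2.+1)
        br (F m (a1 ++ (z.1 + total (rcons a2 y), i : nat) :: b))
           (reducedr K (z.2 - i) (rcons a2 y)))).
Proof.
rewrite /substitute /tau.
under eq_cut => a r _ do rewrite cutD cutB.
rewrite cutD cutB; congr (_ - _ + _).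
- apply: eq_cut => a r _.
  exact: (cut_seq1 r (fun y b => if y.2 is n.+1 then
    br (F m (a ++ (y.1, n) :: b)) (l y.1) else 0)).
- by apply: eq_cut => a r _; rewrite mark_onlast.
- rewrite [RHS]mark_onlast.
  under [RHS]eq_cut => q b _.
    rewrite (onlast_mark q (g := fun a1 z p => \sum_(i < z.2.+1)
        br (F m (a1 ++ (z.1 + total p, i : nat) :: b)) (reducedr K (z.2 - i)
          p))).
      over.
    by move=> a1 z; rewrite big1 // => i _; rewrite (br0r brDr).
  by rewrite cutA.
Qed.

Lemma gauged_insert a g n b m :
  f ((yword 0 a ++ zeros n) ++ Some (total a + g) :: yword (total a + g) b ++
    zeros m)
  = F m (a ++ (g, n) :: b).
Proof.
rewrite -(gauged_yword c_short c_rot c_scale c_zeros c_one_zeros c_scale2).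
by rewrite yword_cat /= add0r -!catA.
Qed.

Lemma gauged_append a y m :
  f ((yword 0 a ++ zeros y.2) ++ Some (total a + y.1) :: zeros m)
  = F m (rcons a y).
Proof.
rewrite -(gauged_yword c_short c_rot c_scale c_zeros c_one_zeros c_scale2).
by rewrite yword_rcons add0r -!catA.
Qed.

(** Each of the three sums of [gauged_cobracket] is translated into block letters; cutting letters 0
    contribute nothing. *)
Lemma cobracket_yword m u :
  necklace_cobracket br c (Some 0 :: yword 0 u ++ zeros m)
  - necklace_cobracket br c (None :: yword 0 u ++ zeros m)
  = cobracket br K l m u.
Proof.
rewrite (gauged_cobracket brDl brDr br_alt c_rot).
(* [R1 a r] and [R2 a r] collect the factors that start right after the prefix [a] and end inside a
   block, respectively in the final zeros; [l (total a)] corrects the case of a single zero. Cuts at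
   the first letter belong to the empty prefix, so [E0] and [E1] combine into a sum over all
   cuts. *)
pose R1 a r : W := mark r (fun b1 y b3 => \sum_(i < y.2.+1)
  br (F m (a ++ (total b1 + y.1, (y.2 - i)%N) :: b3)) 
     (F i b1 + if nilp b1 && (i == 1%N :> nat) then l (total a) else 0)).
pose R2 a r : W := \sum_(i < m.+1)
  br (F (m - i) a) (F i r + if nilp r && (i == 1%N :> nat) then l (total a)
    else 0).
have E0 : cut (yword 0 u ++ zeros m) (fun p q => br (f p) (f q))
    = - (R1 [::] u + R2 [::] u).
  have l00 : l (total [::]) = 0.
    by rewrite /total big_nil; apply: (log0 c_rot c_scale2).
  have -> : R2 [::] u = 0 by rewrite /R2 big1 // => i _; rewrite (br0l brDl).
  rewrite addr0 cut_yword [X in _ + X]big1 => [|i _]; last first.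
    by rewrite gauged_zeros // (log0 c_rot c_scale2) if_same (br0r brDr).
  rewrite addr0 /R1 -markN; apply: eq_mark => a y b _.
  rewrite -sumrN; apply: eq_bigr => i _.
  rewrite l00 if_same addr0 -(brC brDl brDr br_alt) add0r.
  rewrite (gauged_yword c_short c_rot c_scale c_zeros c_one_zeros c_scale2).
  congr (br _ _); rewrite -[_ :: b]cat0s -gauged_insert /=.
  by rewrite /total big_nil add0r.
have E1 : mark (yword 0 u ++ zeros m) (fun a z b => cut b (fun p b' =>
      br (f (a ++ z :: b')) (gauged c None z p)))
    = mark u (fun a y b => R1 (rcons a y) b + R2 (rcons a y) b).
  rewrite mark_yword => [|a b]; last first.
    by rewrite -[RHS](cut0 W b); apply: eq_cut => p q _;
      rewrite gauged_none (br0r brDr).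
  apply: eq_mark => a y b _; rewrite add0r -total_rcons cut_yword.
  congr (_ + _); last first.
    apply: eq_bigr => i _.
    by rewrite total_rcons gauged_append -total_rcons gauged_yword_from.
  apply: eq_mark => b1 z b3 _; apply: eq_bigr => i _.
  rewrite gauged_yword_from //; congr (br _ _).
  by rewrite -gauged_insert yword_rcons add0r -total_rcons !addrA -!catA.
have E2 : mark (yword 0 u ++ zeros m) (fun a z b => cut a (fun a' p =>
      br (f (a' ++ z :: b)) (gauged c None z p)))
    = mark u (fun a y b => mark a (fun a1 z a2 => \sum_(i < z.2.+1)
        br (F m (a1 ++ (z.1 + total (rcons a2 y), i : nat) :: b))
           (reducedr K (z.2 - i) (rcons a2 y))))
     + mark u (fun a y b => if y.2 is n.+1 then
          br (F m (a ++ (y.1, n) :: b)) (l (total a + y.1)) else 0).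
  rewrite mark_yword => [|a b]; last first.
    by rewrite -[RHS](cut0 W a); apply: eq_cut => p q _;
      rewrite gauged_none (br0r brDr).
  rewrite -markD; apply: eq_mark => a y b _; rewrite add0r cut_yword.
  congr (_ + _).
    apply: eq_mark => a1 z a2 aE; apply: eq_bigr => i _.
    have -> : total a = total a1 + (z.1 + total a2).
      by rewrite -aE /total big_cat big_cons.
    rewrite add0r !addrA gauged_yword_last // total_rcons.
    by rewrite -gauged_insert !addrA.
  rewrite -(sum_eq1_rev y.2 (fun i => br (F m (a ++ (y.1,
    i) :: b)) (l (total a + y.1)))).
  apply: eq_bigr => i _; rewrite gauged_zeros // gauged_insert.
  by case: ifP => _; rewrite ?(br0r brDr).
rewrite E0 E1 E2 -opprD -(cut_mark u (fun a r => R1 a r + R2 a r)) cutD.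
have ER1 : cut u R1 = cut u (fun a r => mark r (fun b1 y b3 => \sum_(i < y.2.+1)
        br (F m (a ++ (y.1 + total b1, i : nat) :: b3)) (F (y.2 - i) b1)))
     + mark u (fun a y b => if y.2 is n.+1 then
          br (F m (a ++ (y.1, n) :: b)) (l (total a)) else 0).
  rewrite -cutD; apply: eq_cut => a r _.
  rewrite /R1 -[X in _ + X](cut_nil r (fun r' => if r' is y :: b then
    if y.2 is n.+1 then br (F m (a ++ (y.1, n) :: b)) (l (total a)) else 0 else
      0)).
  rewrite -cutD; apply: eq_cut => b1 [|y b3] _; first by case: b1;
    rewrite addr0.
  under eq_bigr => i _ do rewrite brDr.
  rewrite big_split; congr (_ + _).
    rewrite addrC (sum_rev y.2 (fun i j =>
      br (F m (a ++ (y.1 + total b1, i) :: b3)) (F j b1))).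
    by apply: eq_bigr => i _; rewrite addrC.
  case: b1 => [|z b1] /=; last by rewrite big1 // => i _; rewrite (br0r brDr).
  rewrite (eq_bigr (fun i : 'I_y.2.+1 => if i == 1%N :> nat then
    br (F m (a ++ (y.1, (y.2 - i)%N) :: b3)) (l (total a)) else 0)) => [|i _].
    rewrite (sum_eq1 y.2 (fun i => br (F m (a ++ (y.1,
      (y.2 - i)%N) :: b3)) (l (total a)))).
    by case: y.2 => // n; rewrite subn1.
  by rewrite /total big_nil add0r; case: ifP => _ //; rewrite (br0r brDr).
have ER2 : cut u R2 = cut u (fun a b => \sum_(i < m.+1) br (F i a) (F (m - i)
  b))
  + (if m is m'.+1 then br (F m' u) (l (total u)) else 0).
  rewrite -(cut_nilr u (fun a => if m is m'.+1 then br (F m' a) (l (total a))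
    else 0)).
  rewrite -cutD; apply: eq_cut => a r _; rewrite /R2.
  under eq_bigr => i _ do rewrite brDr.
  rewrite big_split; congr (_ + _).
    by rewrite (sum_rev m (fun i j => br (F i a) (F j r))).
  case: r => [|y r] /=; last by rewrite big1 // => i _; rewrite (br0r brDr).
  rewrite (eq_bigr (fun i : 'I_m.+1 => if i == 1%N :> nat then
    br (F (m - i) a) (l (total a)) else 0)) => [|i _].
    rewrite (sum_eq1 m (fun i => br (F (m - i) a) (l (total a)))).
    by case: (m) => // n; rewrite subn1.
  by case: ifP => _ //; rewrite (br0r brDr).
rewrite ER1 ER2 /cobracket substitute_tauE.
(* A factor that is a single zero yields the logarithm of the letter after it and minus that of the
   letter before it; their difference [l y.1] is the contribution of [tau0]. *)
have -> : mark u (fun a y b => if y.2 is n.+1 then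
      br (F m (a ++ (y.1, n) :: b)) (l (total a + y.1)) else 0)
  = mark u (fun a y b => if y.2 is n.+1 then
      br (F m (a ++ (y.1, n) :: b)) (l (total a)) else 0)
  + mark u (fun a y b => if y.2 is n.+1 then
      br (F m (a ++ (y.1, n) :: b)) (l y.1) else 0).
  rewrite -markD; apply: eq_mark => a [g [|n]] b _ /=; first by rewrite addr0.
  by rewrite /l (log_additive c_rot c_scale2) brDr.
by abel.
Qed.

End CobracketWords.

(** * Rotation and scaling of the necklace cobracket *)

Lemma mark_rot (T : Type) (W : zmodType) (s : seq T) (h : seq T -> W) :
  mark s (fun a z b => h (z :: b ++ a)) = \sum_(k < size s) h (rot k s).
Proof.
rewrite /mark cut_sum big_ord_recr /= drop_size addr0.
apply: eq_bigr => i _; rewrite /rot.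
case: (drop i s) (size_drop i s) => //= /eqP.
by rewrite eq_sym subn_eq0 leqNgt ltn_ord.
Qed.

Lemma sum_rot1S (T : Type) (W : zmodType) (s : seq T) (h : seq T -> W) :
  \sum_(k < size s) h (rot 1 (rot k s)) = \sum_(k < size s) h (rot k s).
Proof.
by rewrite -[RHS]sum_rot1; apply: eq_bigr => k _; rewrite rot_rot.
Qed.

Section NecklaceInvariance.
Variables (T : Type) (V W : zmodType) (br : V -> V -> W) (c : seq T -> V).

Lemma necklace_cobracketE s : necklace_cobracket br c s =
  \sum_(k < size s) (if rot k s is z :: w then
    cut w (fun p q => br (c (z :: p)) (c (z :: q))) else 0).
Proof.
exact: (mark_rot s (fun r => if r is z :: w then
    cut w (fun p q => br (c (z :: p)) (c (z :: q))) else 0)).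
Qed.

Lemma necklace_cobracket_rot1 s :
  necklace_cobracket br c (rot 1 s) = necklace_cobracket br c s.
Proof.
rewrite !necklace_cobracketE size_rot.
exact: (sum_rot1 (fun r => if r is z :: w then
    cut w (fun p q => br (c (z :: p)) (c (z :: q))) else 0)).
Qed.

End NecklaceInvariance.

Lemma cut_map (S T : Type) (W : zmodType) (f : S -> T) (s : seq S)
    (h : seq T -> seq T -> W) :
  cut (map f s) h = cut s (fun a b => h (map f a) (map f b)).
Proof. by elim: s h => //= x s IHs h; rewrite IHs. Qed.

Section NecklaceScaling.
Variable G : zmodType.
Local Notation Y := (G * nat)%type.
Implicit Types (g : G) (y : Y) (u : seq Y) (m n : nat).
Local Notation zeros n := (nseq n (None : letter G)).

Variables (V W : zmodType) (br : V -> V -> W).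
Hypothesis brDl : forall a b c, br (a + b) c = br a c + br b c.
Hypothesis brDr : forall a b c, br a (b + c) = br a b + br a c.
Hypothesis br_alt : forall a, br a a = 0.

Variable c : word G -> V.
Hypothesis c_short : forall s, (size s < 2)%N -> c s = 0.
Hypothesis c_rot : forall s, c (rot 1 s) = c s.
Hypothesis c_scale : forall a s, (2 < size s)%N -> c (map (lscale a) s) = c s.

Let l g := c [:: None; Some g].
Hypothesis c_scale2 : forall a (x z : letter G), ~ (x = None /\ z = None) ->
  c [:: lscale a x; lscale a z] = l a + c [:: x; z].

(** The defect of scale invariance, concentrated in weight 1. *)
Definition anomaly a (s : word G) : V :=
  if s is [:: x; z] then if isSome x || isSome z then l a else 0 else 0.

Lemma c_map_lscale a s : c (map (lscale a) s) = c s + anomaly a s.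
Proof.
case: s => [|x [|z [|t s]]]; rewrite /anomaly ?addr0.
- by [].
- by rewrite !c_short.
- case: x z => [x|] [z|] /=; rewrite ?addr0 //.
  + by rewrite [RHS]addrC -(@c_scale2 a (Some x) (Some z)) //; case.
  + by rewrite [RHS]addrC -(@c_scale2 a (Some x) None) //; case.
  + by rewrite [RHS]addrC -(@c_scale2 a None (Some z)) //; case.
- by rewrite c_scale.
Qed.

Lemma anomaly_alt a s t : br (anomaly a s) (anomaly a t) = 0.
Proof.
have anomalyP r : anomaly a r = 0 \/ anomaly a r = l a.
  by case: r => [|x [|z [|? ?]]] /=; auto; case: ifP; auto.
case: (anomalyP s) => ->; first exact: (br0l brDl).
by case: (anomalyP t) => ->; [exact: (br0r brDr) | exact: br_alt].
Qed.

(* The letter that the anomaly removes from the word is either of the two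
   letters of a cyclically adjacent pair, so the two contributions telescope
   around the necklace; a pair of zeros has no anomaly, but its two deletions
   coincide. *)
Lemma anomaly_telescope a s : (1 < size s)%N ->
  \sum_(k < size s) (if rot k s is z :: w then
    cut w (fun p q => br (anomaly a (z :: p)) (c (z :: q))) else 0)
  = \sum_(k < size s) (if rot k s is z :: w then
    cut w (fun p q => br (anomaly a (z :: q)) (c (z :: p))) else 0).
Proof.
move=> s_gt1.
pose head2 (x z : letter G) v := br (anomaly a [:: x; z]) (c (x :: v)).
pose Phi1 (r : word G) : W := if r is z :: t :: w then head2 z t w else 0.
pose Phi2 (r : word G) : W := if r is z :: t :: w then head2 t z w else 0.
pose Psi1 (r : word G) : W := if r is z :: t :: w then br (l a) (c (z :: w))
  else 0.
pose Psi2 (r : word G) : W := br (l a) (c (behead r)).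
pose Theta (r : word G) : W := if r is z :: w then
    cut w (fun p q => br (anomaly a (z :: q)) (c (z :: p))) else 0.
transitivity (\sum_(k < size s) Phi1 (rot k s)).
  apply: eq_bigr => k _; case: (rot k s) => [|z w] //=.
  rewrite -(cut_seq1 w (fun t => head2 z t));
    apply: eq_cut => [[|t [|t' p]] q _];
    by rewrite /= ?(br0l brDl).
transitivity (\sum_(k < size s) Phi2 (rot k s)); last first.
  rewrite -[RHS](sum_rot1S s Theta); apply: eq_bigr => k _.
  case: (rot k s) => [|z [|t w]] //; first by rewrite /rot /= (br0l brDl).
  rewrite rot1_cons /= -(cut_seq1r w z (fun p x => head2 t x p)).
  by apply: eq_cut => p [|x [|x' q]] _; rewrite /= ?(br0l brDl).
apply/eqP; rewrite -subr_eq0 -sumrB.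
rewrite (eq_bigr (fun k : 'I_(size s) => Psi1 (rot k s) - Psi2 (rot k s))).
  rewrite sumrB subr_eq0 -[X in _ == X](sum_rot1S s Psi2); apply/eqP.
  apply: eq_bigr => k _; case: (rot k s) (size_rot k s) => [|z [|t w]] /= sz;
    rewrite -?sz // in s_gt1 *.
  by rewrite rot1_cons /Psi2 /= -(c_rot (z :: w)) rot1_cons.
move=> k _; case: (rot k s) (size_rot k s) => [|z [|t w]] /= sz;
  rewrite -?sz // in s_gt1 *.
rewrite /Phi1 /Phi2 /head2 /Psi1 /Psi2 /anomaly orbC.
by case: z t => [z|] [t|] //=; rewrite !subrr.
Qed.

(** The terms linear in the anomaly cancel by telescoping, the quadratic ones because all anomalies
    lie in {0, [l a]}. No exception remains, even for words of length two. *)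
Lemma necklace_cobracket_scale a s : (1 < size s)%N ->
  necklace_cobracket br c (map (lscale a) s) = necklace_cobracket br c s.
Proof.
move=> s_gt1; rewrite !necklace_cobracketE size_map.
under eq_bigr => k _.
  rewrite -map_rot (_ : (if _ is z :: w then _ else _) =
    (if rot k s is z :: w then
       cut w (fun p q => br (c (z :: p)) (c (z :: q))) else 0)
    + ((if rot k s is z :: w then
         cut w (fun p q => br (anomaly a (z :: p)) (c (z :: q))) else 0)
      - (if rot k s is z :: w then
         cut w (fun p q => br (anomaly a (z :: q)) (c (z :: p))) else 0)));
           last first.
    case: (rot k s) => [|z w] /=; first by rewrite subrr addr0.
    rewrite cut_map -cutB -cutD; apply: eq_cut => p q _.
    rewrite -!map_cons !c_map_lscale !brDl !brDr.
    rewrite [br (c _) (anomaly _ _)](brC brDl brDr br_alt).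
    by rewrite anomaly_alt; abel.
  over.
by rewrite big_split /= sumrB anomaly_telescope // subrr addr0.
Qed.

Hypothesis c_zeros : forall n, c (zeros n) = 0.
Hypothesis c_one_zeros : forall n, c (Some 0 :: zeros n) = 0.

Local Notation N := (necklace_cobracket br c).

Lemma necklace_cobracket_zeros n : N (zeros n) = 0.
Proof.
rewrite necklace_cobracketE big1 // => k _.
have -> : rot k (zeros n) = zeros n.
  apply: (@eq_from_nth _ None) => [|i _]; first by rewrite size_rot.
  have none x : x \in zeros n -> x = None by rewrite mem_nseq => /andP[_ /eqP].
  rewrite nth_nseq if_same; have [lt_i|le_i] := ltnP i (size (rot k (zeros n))).
    by apply: none; rewrite -(mem_rot k) mem_nth.
  by rewrite nth_default.
case: {k}n => [|n] //=; rewrite -[RHS](cut0 W (zeros n)).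
apply: eq_cut => p q pq.
have -> : p = zeros (size p).
  by rewrite -(take_size_cat q (erefl (size p))) pq take_nseq ?size_nseq //
    -(size_nseq n (None : letter G)) -pq size_cat leq_addr.
by rewrite (c_zeros (size p).+1) (br0l brDl).
Qed.

(** The reduced values of the cobracket are given by [cobracket], which kills quasi-shuffle
    products; [doubly_shuffling_of_reduced] returns to the unreduced relations. *)
Lemma necklace_cobracket_doubly_shuffling :
  doubly_shuffling (cyclic_value c) -> doubly_shuffling (cyclic_value N).
Proof.
move=> KE.
have l_add a b : l (a + b) = l a + l b by apply: (log_additive c_rot c_scale2).
have coE m u := cobracket_yword brDl brDr br_alt c_short c_rot c_scale c_zeros
  c_one_zeros c_scale2 m u.
have N_nil m : cyclic_value N m [::] = 0.
  have := coE m [::]; rewrite (necklace_cobracket_zeros m.+1) subr0 => coE0.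
  rewrite [LHS]coE0.
  rewrite /cobracket /substitute /= tau_nil // big1 => [|i _];
    last exact: (br0l brDl).
  by case: (m) => [|n]; rewrite ?(br0l brDl) !subr0.
(* The cobracket [N] is itself invariant under rotation and scaling, so [first_block_cyclic] applies
   to it, without any logarithm. *)
have first_N y u m : (1 < size (yword 0 (y :: u) ++ zeros m))%N ->
    cobracket br (cyclic_value c) l m (y :: u) =
    cyclic_value N m (y :: u) - cyclic_value N (m + y.2).+1 u.
  move=> sz; rewrite -coE first_block_cyclic //.
    by move=> s; apply: necklace_cobracket_rot1.
  by move=> a s s_gt2; apply: necklace_cobracket_scale; apply: ltnW.
apply: doubly_shuffling_of_reduced => // y u z v m.
rewrite -(@stuffle_reducedl _ _ _ N_nil y u z v m (cobracket br (cyclic_value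
  c) l m)).
- by apply: cobracket_stuffle => // k; apply: cyclic_value_nil.
- move=> x [|t w] // _; apply: first_N.
  by rewrite size_cat size_yword !weight_cons; lia.
- rewrite first_N ?N_nil ?subr0 //.
  by rewrite size_cat size_yword weight_cons /merge /=; lia.
Qed.

End NecklaceScaling.
(** * Quasi-shuffle surjections *)

Section Paths.

(* A step (a, b) of a path takes a letter from the left word if a, and from the
   right word if b. *)
Definition step : Type := (bool * bool)%type.

(** Lattice paths from (0,0) to (r,s) with horizontal, vertical and diagonal steps: an index set for
    quasi-shuffles that follows the recursion of [stuffle]. *)
Fixpoint paths (r : nat) : nat -> seq (seq step) :=
  fix paths_r (s : nat) : seq (seq step) :=
  match r, s with
  | 0, 0 => [:: [::]]
  | 0, s'.+1 => [seq (false, true) :: p | p <- paths_r s']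
  | r'.+1, 0 => [seq (true, false) :: p | p <- paths r' 0]
  | r'.+1, s'.+1 =>
      [seq (true, false) :: p | p <- paths r' s'.+1]
      ++ [seq (false, true) :: p | p <- paths_r s']
      ++ [seq (true, true) :: p | p <- paths r' s']
  end.

Arguments paths : simpl never.

Lemma paths_0S s : paths 0 s.+1 = [seq (false, true) :: p | p <- paths 0 s].
Proof. by []. Qed.

Lemma paths_S0 r : paths r.+1 0 = [seq (true, false) :: p | p <- paths r 0].
Proof. by []. Qed.

Lemma paths_SS r s : paths r.+1 s.+1 =
  [seq (true, false) :: p | p <- paths r s.+1]
  ++ [seq (false, true) :: p | p <- paths r.+1 s]
  ++ [seq (true, true) :: p | p <- paths r s].
Proof. by []. Qed.

Definition is_path r s (p : seq step) : bool :=
  [&& count fst p == r, count snd p == s & all (fun x => x.1 || x.2) p].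

Lemma mem_map_cons (x y : step) p (l : seq (seq step)) :
  (x :: p \in [seq y :: q | q <- l]) = (x == y) && (p \in l).
Proof.
apply/mapP/andP => [[q lq [-> ->]]|[/eqP -> lp]]; first by [].
by exists p.
Qed.

Lemma nil_map_cons (y : step) (l : seq (seq step)) :
  ([::] \in [seq y :: q | q <- l]) = false.
Proof. by apply/mapP => [[]]. Qed.

Lemma mem_paths r s p : (p \in paths r s) = is_path r s p.
Proof.
elim: p r s => [|x p IHp] [|r] [|s];
  rewrite ?paths_0S ?paths_S0 ?paths_SS ?mem_cat ?nil_map_cons ?mem_map_cons
    ?IHp /is_path //=;
  case: x => [[] []] //=; rewrite ?add0n ?add1n ?eqSS ?andbF ?orbF //.
Qed.

Lemma uniq_paths r s : uniq (paths r s).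
Proof.
have inj y : injective (cons (y : step)) by move=> p q [].
elim: r s => [|r IHr] s.
  by elim: s => // s IHs; rewrite paths_0S map_inj_uniq.
elim: s => [|s IHs]; first by rewrite paths_S0 map_inj_uniq.
rewrite paths_SS !cat_uniq !map_inj_uniq // !IHr IHs /= andbT.
rewrite -!all_predC; apply/andP; split; apply/allP => p /=.
  by rewrite mem_cat => /orP[] /mapP[q _ ->]; rewrite mem_map_cons.
by move=> /mapP[q _ ->]; rewrite mem_map_cons.
Qed.

Lemma size_is_path r s p : is_path r s p -> (size p <= r + s)%N.
Proof.
case/and3P => /eqP <- /eqP <- {r s}; elim: p => //= x p IHp /andP[x0 /IHp].
by case: x x0 => [[] []] //= _; lia.
Qed.

Variables (T : Type) (op : T -> T -> T).

(** The last case of the match never arises for a path in [paths (size u) (size v)]. *)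
Fixpoint weave (p : seq step) (u v : seq T) : seq T :=
  if p is x :: p' then
    match x, u, v with
    | (true, false), y :: u', _ => y :: weave p' u' v
    | (false, true), _, z :: v' => z :: weave p' u v'
    | (true, true), y :: u', z :: v' => op y z :: weave p' u' v'
    | _, _, _ => weave p' u v
    end
  else [::].

(** The exponent is the number of diagonal steps, that is, of mergings. *)
Lemma stuffle_paths (W : lmodType rat) u v (H : seq T -> W) :
  stuffle op u v H = \sum_(p <- paths (size u) (size v))
    (-1) ^+ (size u + size v - size p) *: H (weave p u v).
Proof.
elim: u v H => [|y u IHu] v H.
  rewrite stuffle_nill; elim: v H => [|z v IHv] H;
    first by rewrite big_seq1 scale1r.
  by rewrite (IHv (fun w => H (z :: w))) paths_0S big_map.
elim: v H => [|z v IHv] H.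
  by rewrite stuffle_nilr paths_S0 big_map -[LHS](stuffle_nilr op u (fun w =>
    H (y :: w))) IHu.
rewrite stuffle_cons !IHu IHv paths_SS !big_cat !big_map.
rewrite -[RHS]/(_ + (_ + _)) addrA.
rewrite -[size (y :: u)]/(size u).+1 -[size (z :: v)]/(size v).+1.
congr (_ + _ + _).
  by apply: eq_bigr => p _; rewrite -[size (_ :: p)]/(size p).+1 addnS subSS.
rewrite -sumrN !big_seq; apply: eq_bigr => p.
rewrite mem_paths => /size_is_path le_p.
by rewrite -[size (_ :: p)]/(size p).+1 addSn addnS subSS subSn // exprS mulN1r
  scaleNr.
Qed.

Lemma weave_filter (K : Type) (a b : pred K) (f g : K -> T) (ks : seq K) :
  all (fun k => a k || b k) ks ->
  weave [seq (a k, b k) | k <- ks] (map f (filter a ks)) (map g (filter b ks))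
  = [seq (if a k then if b k then op (f k) (g k) else f k else g k) | k <- ks].
Proof.
elim: ks => //= k ks IHks /andP[abk /IHks <-].
by case: (a k) (b k) abk => [] [].
Qed.

End Paths.

Section Hits.
Variables (m M : nat) (P : pred 'I_m) (sigma : 'I_m -> 'I_M).
Hypothesis sigma_incr : forall i j, P i -> P j -> (i < j)%N -> (sigma i < sigma
  j)%N.

Lemma sigma_inj i j : P i -> P j -> sigma i = sigma j -> i = j.
Proof.
move=> Pi Pj e; apply: val_inj; case: (ltngtP i j) => // [ij|ji].
  by have := sigma_incr Pi Pj ij; rewrite e ltnn.
by have := sigma_incr Pj Pi ji; rewrite e ltnn.
Qed.

Definition hit (k : 'I_M) : option 'I_m := [pick i | P i && (sigma i == k)].

Lemma hitE i : P i -> hit (sigma i) = Some i.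
Proof.
move=> Pi; rewrite /hit; case: pickP => [j /andP[Pj /eqP e]|/(_ i)].
  by congr Some; apply: sigma_inj.
by rewrite Pi eqxx.
Qed.

Lemma sum_hit (V : nmodType) (F : 'I_m -> V) k :
  \sum_(i | P i && (sigma i == k)) F i = if hit k is Some i then F i else 0.
Proof.
rewrite /hit; case: pickP => [j /andP[Pj /eqP e]|none];
  last by rewrite big_pred0.
rewrite (big_pred1 j) // => i /=; apply/andP/eqP => [[Pi /eqP ei]|->].
  by apply: sigma_inj; rewrite ?ei.
by rewrite Pj e.
Qed.

Lemma sorted_enum_ord n (Q : pred 'I_n) :
  sorted (fun i j : 'I_n => i < j)%N [seq i <- enum 'I_n | Q i].
Proof.
apply: sorted_filter; first by move=> ? ? ?; apply: ltn_trans.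
by have := iota_ltn_sorted 0 n; rewrite -val_enum_ord sorted_map.
Qed.

(** Both lists are strictly increasing and have the same members. Hence [sigma] is determined on [P]
    by the set of values it takes there. *)
Lemma map_hit : [seq sigma i | i <- enum 'I_m & P i]
  = [seq k <- enum 'I_M | hit k : bool].
Proof.
apply: (@irr_sorted_eq _ (fun i j : 'I_M => i < j)%N).
- by move=> ? ? ?; apply: ltn_trans.
- by move=> i; apply: ltnn.
- have := sorted_enum_ord P.
  apply: (@homo_sorted_in _ _ P) => [i j Pi Pj|]; first exact: sigma_incr.
  by apply/allP => i; rewrite mem_filter => /andP[].
- exact: sorted_enum_ord.
move=> k; rewrite mem_filter mem_enum andbT; apply/mapP/idP => [[i]|].
  by rewrite mem_filter => /andP[Pi _] ->; rewrite hitE.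
rewrite /hit; case: pickP => // i /andP[Pi /eqP <-] _.
by exists i; rewrite // mem_filter Pi mem_enum.
Qed.

End Hits.

Section QuasiShuffles.
Variables (G : zmodType) (r s : nat).
Local Notation Y := (G * nat)%type.
Variables (w : 'I_(r + s).+1 -> G) (n : 'I_(r + s).+1 -> nat).

Let left (i : 'I_(r + s)) := (i < r)%N.
Let right (i : 'I_(r + s)) := ~~ (i < r)%N.
Let letter_at (i : 'I_(r + s).+1) : Y := (w i, n i).

Lemma enum_block1 : enum (block1 r s)
  = [seq lift ord0 i | i <- enum 'I_(r + s) & left i].
Proof.
have -> : enum (block1 r s) = [seq i <- enum 'I_(r + s).+1 | i \in block1 r s].
  by rewrite enumT.
rewrite enum_ordSl /= inE /= filter_map; congr map; apply: eq_filter => i.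
by rewrite /= inE.
Qed.

Lemma enum_block2 : enum (block2 r s)
  = [seq lift ord0 i | i <- enum 'I_(r + s) & right i].
Proof.
have -> : enum (block2 r s) = [seq i <- enum 'I_(r + s).+1 | i \in block2 r s].
  by rewrite enumT.
rewrite enum_ordSl /= inE /= filter_map; congr map; apply: eq_filter => i.
by rewrite /= inE /right -leqNgt.
Qed.

Lemma val_left : [seq val i | i <- [seq i <- enum 'I_(r + s) | left i]] = iota
  0 r.
Proof.
rewrite -(filter_map val (fun i => i < r)%N) val_enum_ord iotaD filter_cat.
rewrite (@eq_in_filter _ _ xpredT (iota 0 r)) => [|i]; last by rewrite mem_iota.
rewrite (@eq_in_filter _ _ pred0 (iota _ s)) ?filter_predT ?filter_pred0 ?cats0
  //.
by move=> i; rewrite mem_iota => /andP[le_i _]; rewrite ltnNge le_i.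
Qed.

Lemma val_right : [seq val i | i <- [seq i <- enum 'I_(r + s) | right i]] =
  iota r s.
Proof.
rewrite -(filter_map val (fun i => ~~ (i < r))%N) val_enum_ord iotaD filter_cat.
rewrite (@eq_in_filter _ _ pred0 (iota 0 r)) => [|i]; last first.
  by rewrite mem_iota /= => ->.
rewrite (@eq_in_filter _ _ xpredT (iota _ s)) ?filter_predT ?filter_pred0 //.
by move=> i; rewrite mem_iota -leqNgt => /andP[].
Qed.

Lemma size_left : size [seq i <- enum 'I_(r + s) | left i] = r.
Proof. by rewrite -(size_map val) val_left size_iota. Qed.

Lemma size_right : size [seq i <- enum 'I_(r + s) | right i] = s.
Proof. by rewrite -(size_map val) val_right size_iota. Qed.

Section FixedLength.
Variable M : nat.
Implicit Types sigma : {ffun 'I_(r + s) -> 'I_M}.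

Definition steps sigma : seq step :=
  [seq (hit left sigma k : bool, hit right sigma k : bool) | k <- enum 'I_M].

Lemma quasi_shuffleP sigma : reflect
  [/\ forall i j, left i -> left j -> (i < j)%N -> (sigma i < sigma j)%N,
      forall i j, right i -> right j -> (i < j)%N -> (sigma i < sigma j)%N
    & forall k, hit left sigma k || hit right sigma k]
  (quasi_shuffle sigma).
Proof.
apply: (iffP andP) => [[/forallP cov /forallP incr]|[incl incr cov]].
  have incr' (i j : 'I_(r + s)) : (i < j)%N -> (i < r)%N = (j < r)%N -> (sigma
    i < sigma j)%N.
    by move=> ij e; move/forallP: (incr i) => /(_ j); rewrite ij e eqxx.
  split.
  - by move=> i j Pi Pj ij; apply: incr'; rewrite // [LHS]Pi [RHS]Pj.
  - by move=> i j /negPf Pi /negPf Pj ij; apply: incr'; rewrite // Pi Pj.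
  - move=> k; have /existsP[i /eqP ik] := cov k.
    rewrite /hit; case: pickP => // nl; case: pickP => // nr.
    by have := nr i; have := nl i; rewrite ik eqxx !andbT /left /right => ->.
split.
  apply/forallP => k; apply/existsP; move: (cov k).
  rewrite /hit; case: pickP => [i /andP[_ ik]|_]; first by exists i.
  by case: pickP => [i /andP[_ ik]|_] // _; exists i.
apply/forallP => i; apply/forallP => j; apply/implyP => /andP[ij /eqP e].
by case Pi: (i < r)%N; [apply: incl | apply: incr];
  rewrite /left /right -?e ?Pi.
Qed.

(** A fiber meets each block in at most one index, since [sigma] is strictly increasing on
    blocks. *)
Lemma merged_fiber sigma k : quasi_shuffle sigma ->
  merged w n (fiber sigma k) =
  (if hit left sigma k is Some i then
     if hit right sigma k is Some j then
       merge (letter_at (lift ord0 i)) (letter_at (lift ord0 j))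
     else letter_at (lift ord0 i)
   else if hit right sigma k is Some j then letter_at (lift ord0 j)
   else (0, 0%N)).
Proof.
case/quasi_shuffleP => incl incr /(_ k) cov.
have sumE (V : nmodType) (F : 'I_(r + s).+1 -> V) :
    \sum_(i in fiber sigma k) F i =
    (if hit left sigma k is Some i then F (lift ord0 i) else 0) +
    (if hit right sigma k is Some i then F (lift ord0 i) else 0).
  rewrite big_imset /=; last by move=> i j _ _; apply: lift_inj.
  rewrite -(sum_hit incl (fun i => F (lift ord0 i))).
  rewrite -(sum_hit incr (fun i => F (lift ord0 i))).
  rewrite (bigID left) /=; congr (_ + _); apply: eq_bigl => i;
    by rewrite inE andbC.
rewrite /merged !sumE; move: cov.
case: (hit left sigma k) (hit right sigma k) => [i|] [j|] //= _.
- by rewrite /merge /= addnS.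
- by rewrite addr0 [X in (_, X)]addr0.
- by rewrite add0r.
Qed.

Lemma weave_steps sigma : quasi_shuffle sigma ->
  weave (@merge G) (steps sigma)
    [seq letter_at i | i <- enum (block1 r s)]
    [seq letter_at i | i <- enum (block2 r s)]
  = [seq merged w n (fiber sigma k) | k <- enum 'I_M].
Proof.
move=> qs; have /quasi_shuffleP[incl incr cov] := qs.
pose f (P : pred 'I_(r + s)) k : Y :=
  if hit P sigma k is Some i then letter_at (lift ord0 i) else (0, 0%N).
have fE (P : pred 'I_(r + s)) :
    (forall i j, P i -> P j -> (i < j)%N -> (sigma i < sigma j)%N) ->
    [seq letter_at i | i <- [seq lift ord0 i | i <- enum 'I_(r + s) & P i]]
    = map (f P) [seq k <- enum 'I_M | hit P sigma k : bool].
  move=> incP; rewrite -map_hit // -!map_comp; apply/eq_in_map => i.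
  by rewrite mem_filter /= /f => /andP[Pi _]; rewrite hitE.
rewrite enum_block1 enum_block2 !fE // weave_filter; last exact/allP.
apply: eq_map => k; rewrite merged_fiber // /f.
by case: (hit left sigma k) (hit right sigma k) => [i|] [j|].
Qed.

Lemma is_path_steps sigma : quasi_shuffle sigma -> is_path r s (steps sigma).
Proof.
case/quasi_shuffleP => incl incr cov; apply/and3P; split.
- rewrite /steps count_map -size_filter /= -(map_hit incl) size_map.
  by rewrite size_left.
- rewrite /steps count_map -size_filter /= -(map_hit incr) size_map.
  by rewrite size_right.
- by rewrite all_map; apply/allP => k _ /=.
Qed.

Lemma steps_inj sigma sigma' :
  quasi_shuffle sigma -> quasi_shuffle sigma' ->
  steps sigma = steps sigma' -> sigma = sigma'.
Proof.
case/quasi_shuffleP => incl incr _ /quasi_shuffleP[incl' incr' _] /eq_in_map e.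
have eqP_ (P : pred 'I_(r + s)) i :
    (forall i j, P i -> P j -> (i < j)%N -> (sigma i < sigma j)%N) ->
    (forall i j, P i -> P j -> (i < j)%N -> (sigma' i < sigma' j)%N) ->
    (forall k, hit P sigma k = hit P sigma' k :> bool) -> P i ->
    sigma i = sigma' i.
  move=> inc inc' eh Pi.
  have := map_hit inc; rewrite (eq_filter eh) -(map_hit inc').
  by move/eq_in_map; apply; rewrite mem_filter Pi mem_enum.
have e1 k : hit left sigma k = hit left sigma' k :> bool.
  by move: (e k); rewrite mem_enum => /(_ isT) [].
have e2 k : hit right sigma k = hit right sigma' k :> bool.
  by move: (e k); rewrite mem_enum => /(_ isT) [].
apply/ffunP => i; case Pi: (left i); first exact: (eqP_ left).
by apply: (eqP_ right); rewrite // /right -/(left i) Pi.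
Qed.

Lemma steps_surj p : is_path r s p -> size p = M ->
  exists2 sigma, quasi_shuffle sigma & steps sigma = p.
Proof.
move=> /and3P[/eqP pr /eqP ps pall] pM.
pose x k := nth (false, false) p k.
have pE : p = [seq x (val k) | k <- enum 'I_M].
  by rewrite (map_comp x val) val_enum_ord -pM map_nth_iota0 ?take_size.
(* [A] and [B] list the places where the path takes a left, respectively a right letter; [sigma]
   runs through [A] on the first block and through [B] on the second. *)
pose A := [seq k <- enum 'I_M | (x (val k)).1].
pose B := [seq k <- enum 'I_M | (x (val k)).2].
have sA : size A = r by rewrite -pr pE count_map size_filter.
have sB : size B = s by rewrite -ps pE count_map size_filter.
have sAB : size (A ++ B) == (r + s)%N by rewrite size_cat sA sB.
pose sigma := [ffun i => tnth (Tuple sAB) i].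
have sigmaE k i : sigma i = nth k (A ++ B) i by rewrite ffunE (tnth_nth k).
have sigmaA k i : left i -> sigma i = nth k A i.
  by move=> Li; rewrite (sigmaE k) nth_cat sA ifT.
have sigmaB k i : right i -> sigma i = nth k B (i - r).
  by move=> Ri; rewrite (sigmaE k) nth_cat sA ifN.
have lt_trans : transitive (fun i j : 'I_M => i < j)%N.
  by move=> ? ? ?; apply: ltn_trans.
have incl i j : left i -> left j -> (i < j)%N -> (sigma i < sigma j)%N.
  move=> Li Lj ij; rewrite (sigmaA (sigma i) i) // (sigmaA (sigma i) j) //.
  by apply: (sorted_ltn_nth lt_trans); rewrite ?sorted_enum_ord ?inE ?sA.
have subr_lt (i : 'I_(r + s)) : right i -> (i - r < s)%N.
  by rewrite /right; move: (ltn_ord i); lia.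
have incr i j : right i -> right j -> (i < j)%N -> (sigma i < sigma j)%N.
  move=> Ri Rj ij; rewrite (sigmaB (sigma i) i) // (sigmaB (sigma i) j) //.
  apply: (sorted_ltn_nth lt_trans); rewrite ?sorted_enum_ord ?inE ?sB ?subr_lt
    //.
  by move: Ri ij; rewrite /right; lia.
have hitA k : hit left sigma k = (x (val k)).1 :> bool.
  apply/idP/idP => [|xk].
    rewrite /hit; case: pickP => // i /andP[Li /eqP ik] _.
    have : k \in A by rewrite -ik (sigmaA k) // mem_nth // sA.
    by rewrite mem_filter => /andP[].
  have kA : k \in A by rewrite mem_filter xk mem_enum.
  have ltk : (index k A < r)%N by rewrite -sA index_mem.
  have ltk' : (index k A < r + s)%N by apply: ltn_addr.
  rewrite -[k in hit _ _ k](nth_index k kA).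
  by rewrite -(sigmaA k (Ordinal ltk')) // hitE.
have hitB k : hit right sigma k = (x (val k)).2 :> bool.
  apply/idP/idP => [|xk].
    rewrite /hit; case: pickP => // i /andP[Ri /eqP ik] _.
    have : k \in B by rewrite -ik (sigmaB k) // mem_nth // sB subr_lt.
    by rewrite mem_filter => /andP[].
  have kB : k \in B by rewrite mem_filter xk mem_enum.
  have ltk : (index k B < s)%N by rewrite -sB index_mem.
  have ltk' : (r + index k B < r + s)%N by rewrite ltn_add2l.
  have Rk : right (Ordinal ltk') by rewrite /right /= -leqNgt leq_addr.
  rewrite -[k in hit _ _ k](nth_index k kB).
  by rewrite -[index k B](addKn r) -(sigmaB k (Ordinal ltk')) // hitE.
exists sigma.
  apply/quasi_shuffleP; split=> // k; rewrite hitA hitB.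
  by move: pall; rewrite pE all_map => /allP /(_ k) /=; apply; rewrite mem_enum.
rewrite [RHS]pE; apply: eq_map => k; rewrite hitA hitB.
by case: (x _).
Qed.

End FixedLength.

(** For each [M], [steps] is a bijection from these surjections onto the paths of length [M]; every
    path has length at most [r + s], so summing over [M] exhausts them. *)
Lemma sum_quasi_shuffles (W : lmodType rat) (H : seq Y -> W) :
  \sum_(M < (r + s).+1)
    \sum_(sigma : {ffun 'I_(r + s) -> 'I_M} | quasi_shuffle sigma)
      (-1) ^+ (r + s - M) *: H [seq merged w n (fiber sigma k) | k <- enum 'I_M]
  = stuffle (@merge G) [seq letter_at i | i <- enum (block1 r s)]
      [seq letter_at i | i <- enum (block2 r s)] H.
Proof.
rewrite stuffle_paths !size_map.
have -> : size (enum (block1 r s)) = r by rewrite enum_block1 size_map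
  size_left.
have -> : size (enum (block2 r s)) = s by rewrite enum_block2 size_map
  size_right.
pose Phi p : W := (-1) ^+ (r + s - size p) *: H (weave (@merge G) p
  [seq letter_at i | i <- enum (block1 r s)]
  [seq letter_at i | i <- enum (block2 r s)]).
transitivity (\sum_(M < (r + s).+1) \sum_(p <- paths r s | size p == M) Phi p).
  apply: eq_bigr => M _; rewrite -[RHS]big_filter.
  rewrite [RHS](perm_big [seq steps sigma | sigma <- enum [pred sigma :
    {ffun 'I_(r + s) -> 'I_M} | quasi_shuffle sigma]]).
    rewrite [RHS]big_map [RHS]big_enum; apply: eq_bigr => sigma qs.
    by rewrite /Phi weave_steps // size_map size_enum_ord.
  apply: uniq_perm; first exact/filter_uniq/uniq_paths.
    rewrite map_inj_in_uniq ?enum_uniq // => sigma sigma'.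
    by rewrite !mem_enum; apply: steps_inj.
  move=> p; rewrite mem_filter mem_paths; apply/andP/mapP => [[/eqP pM pp]|].
    have [sigma qs <-] := steps_surj pp pM.
    by exists sigma; rewrite ?mem_enum.
  case=> sigma; rewrite mem_enum => qs ->.
  by rewrite size_map size_enum_ord is_path_steps.
rewrite (exchange_big_dep xpredT) //= big_seq [RHS]big_seq.
apply: eq_bigr => p; rewrite mem_paths => /size_is_path le_p.
rewrite (big_pred1 (inord (size p))) // => M /=.
by rewrite -val_eqE /= inordK // eq_sym.
Qed.

Lemma sum_blocks (V : zmodType) (F : 'I_(r + s).+1 -> V) :
  \sum_i F i = F ord0 + (\sum_(i in block1 r s) F i + \sum_(i in block2 r s) F
    i).
Proof.
rewrite big_ord_recl -[\sum_(i in block1 r s) _]big_enum.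
rewrite -[\sum_(i in block2 r s) _]big_enum enum_block1 enum_block2 !big_map.
by rewrite !big_filter !big_enum_cond (bigID left).
Qed.

Lemma merged_setU1 (A : {set 'I_(r + s).+1}) : ord0 \notin A ->
  merged w n (ord0 |: A) =
  (w ord0 + \sum_(i in A) w i, (n ord0 + \sum_(i in A) (n i).+1)%N).
Proof. by move=> A0; rewrite /merged !big_setU1. Qed.

Lemma letters_block1 (u v : seq Y) y0 : size u = r -> size v = s ->
  (forall i : 'I_(r + s).+1, letter_at i = nth (0, 0%N) (y0 :: u ++ v) i) ->
  [seq letter_at i | i <- enum (block1 r s)] = u.
Proof.
move=> ur vs E; rewrite enum_block1 -map_comp.
rewrite (eq_map (g := nth (0, 0%N) (u ++ v) \o val)); last by move=> i;
  rewrite /= E.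
rewrite map_comp val_left map_nth_iota0 ?size_cat ?ur ?leq_addr //.
by rewrite -ur take_size_cat.
Qed.

Lemma letters_block2 (u v : seq Y) y0 : size u = r -> size v = s ->
  (forall i : 'I_(r + s).+1, letter_at i = nth (0, 0%N) (y0 :: u ++ v) i) ->
  [seq letter_at i | i <- enum (block2 r s)] = v.
Proof.
move=> ur vs E; rewrite enum_block2 -map_comp.
rewrite (eq_map (g := nth (0, 0%N) (u ++ v) \o val)); last by move=> i;
  rewrite /= E.
rewrite map_comp val_right map_nth_iota ?size_cat ?ur ?vs //;
  last by rewrite addKn.
by rewrite -{1}ur drop_size_cat // -vs take_size.
Qed.

End QuasiShuffles.
(** * Second shuffles *)

Section SecondShuffleValues.
Variable G : zmodType.
Local Notation Y := (G * nat)%type.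
Implicit Types (y : Y) (u v : seq Y) (m : nat).
Local Notation zeros n := (nseq n (None : letter G)).

Lemma flatten_blocks g u :
  flatten (mkseq (fun j => rcons (zeros (nth (0, 0%N) u j).2)
    (Some (g + \sum_(0 <= i < j.+1) (nth (0, 0%N) u i).1))) (size u))
  = yword g u.
Proof.
elim: u g => [|y u IHu] g //=.
rewrite big_nat1 -cats1 -catA /=; congr (_ ++ _ :: _).
rewrite -IHu -[1%N]addn0 iotaDl -map_comp; congr flatten.
apply: eq_map => j /=; congr (rcons _ (Some _)).
by rewrite [in LHS]big_nat_recl // addrA.
Qed.

Lemma Cstar_cons y u : Cstar (y :: u) = C (zeros y.2 ++ Some 0 :: yword 0 u).
Proof.
rewrite /Cstar -flatten_blocks /=; congr C.
rewrite big_geq // -cats1 -catA /=; congr (_ ++ _ :: _); congr flatten.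
rewrite -[1%N]addn0 iotaDl -map_comp; apply: eq_map => j /=.
by congr (rcons _ (Some _)); rewrite add0r big_add1.
Qed.

Variables (W : lmodType rat) (q : {linear cyc G -> W}).
Hypothesis q_scale : forall a (x : word G), (2 < size x)%N ->
  q (C (map (lscale a) x)) = q (C x).

Local Notation K := (cyclic_value (fun x => q (C x))).

(** Rescaling by the first entry of [u] turns the last letter into the unit, because the total is
    trivial; this letter is then rotated to the front. The bound on the weight makes scaling
    available. *)
Lemma q_Cstar u g m : total u + g = 0 -> (0 < weight u)%N ->
  (1 < weight u + m)%N -> q (Cstar (rcons u (g, m))) = K m u.
Proof.
case: u => [|y u]; first by rewrite /weight big_nil.
rewrite total_cons rcons_cons Cstar_cons => ug _ wu.
rewrite -(@q_scale y.1); last first.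
  rewrite size_cat /= size_nseq size_yword weight_rcons.
  by move: wu; rewrite weight_cons /=; lia.
rewrite map_cat map_cons map_nseq map_lscale_yword addr0 yword_rcons /= ug.
rewrite addr0 /cyclic_value /= -cat_cons !catA.
rewrite (rot_invariant_cat (c := fun x => q (C x))) => [|x];
  last by rewrite C_rot1.
by rewrite /= add0r -!catA /=.
Qed.

Section Values.
Variables (r s : nat) (w : 'I_(r + s).+1 -> G) (n : 'I_(r + s).+1 -> nat).
Hypotheses (r_gt0 : (0 < r)%N) (s_gt0 : (0 < s)%N) (w0 : \sum_i w i = 0).

Let u : seq Y := [seq (w i, n i) | i <- enum (block1 r s)].
Let v : seq Y := [seq (w i, n i) | i <- enum (block2 r s)].

(** Stated for any scale invariant [q], because it serves twice: for the projection to D(G), and for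
    the cobracket modulo the ideal. *)
Lemma q_second_shuffle : q (second_shuffle w n) =
  stuffle (@merge G) u v (K (n ord0))
  - K (n ord0 + weight v)%N u - K (n ord0 + weight u)%N v.
Proof.
have tu : total u = \sum_(i in block1 r s) w i.
  by rewrite /total big_map big_enum.
have tv : total v = \sum_(i in block2 r s) w i.
  by rewrite /total big_map big_enum.
have wu : weight u = (\sum_(i in block1 r s) (n i).+1)%N.
  by rewrite /weight big_map big_enum.
have wv : weight v = (\sum_(i in block2 r s) (n i).+1)%N.
  by rewrite /weight big_map big_enum.
have tuv : w ord0 + (total u + total v) = 0 by rewrite tu tv -sum_blocks.
have size_weight (x : seq Y) : (size x <= weight x)%N.
  by elim: x => // y x IHx; rewrite weight_cons /=; lia.
have u_gt0 : (0 < weight u)%N.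
  apply: leq_trans (size_weight u).
  by rewrite size_map enum_block1 size_map size_left.
have v_gt0 : (0 < weight v)%N.
  apply: leq_trans (size_weight v).
  by rewrite size_map enum_block2 size_map size_right.
rewrite /second_shuffle !linearB; congr (_ - _ - _).
- rewrite linear_sum.
  under eq_bigr => M _.
    rewrite linear_sum; under eq_bigr => sigma _ do rewrite linearZ /=.
    over.
  rewrite (sum_quasi_shuffles w n (fun x => q (Cstar (rcons x (w ord0,
    n ord0))))).
  (* [q_Cstar] needs both the weight and the total of [x], while [eq_stuffle] tracks one statistic
     at a time; the conditional carries the bound on the weight over to the second application. *)
  transitivity (stuffle (@merge G) u v (fun x => if (1 < weight x)%N then
      q (Cstar (rcons x (w ord0, n ord0))) else K (n ord0) x)).
    apply: (@eq_stuffle _ _ _ _ (fun y : Y => y.2.+1)).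
      by move=> y z; rewrite -[RHS]/(y.2.+1 + z.2.+1)%N addSn addnS.
    move=> x _ _ wx; rewrite ifT // [weight x]wx.
    by rewrite -/(weight u) -/(weight v); lia.
  apply: (@eq_stuffle _ _ _ _ (fun y : Y => y.1)) => // x _ _ tx.
  case: ifP => // lt_x; rewrite q_Cstar ?(ltnW lt_x) ?ltn_addr // [total x]tx.
  by rewrite -/(total u) -/(total v) addrC.
- rewrite merged_setU1 ?inE // -tv -wv q_Cstar //.
    by rewrite addrCA.
  by rewrite -/u; lia.
- rewrite merged_setU1 ?inE // -tu -wu q_Cstar //.
    by rewrite addrCA [total v + _]addrC.
  by rewrite -/v; lia.
Qed.

End Values.
End SecondShuffleValues.
(** * The coideal *)

Section Coideal.
Variable G : zmodType.
Local Notation Y := (G * nat)%type.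
Local Notation zeros n := (nseq n (None : letter G)).

Lemma lspan_linear (F : fieldType) (V W : lmodType F) (q : {linear V -> W})
    (S : V -> Prop) (P : W -> Prop) :
  P 0 -> (forall a x y, P x -> P y -> P (a *: x + y)) ->
  (forall x, S x -> P (q x)) -> forall x, lspan S x -> P (q x).
Proof.
move=> P0 PD PS x; elim=> [u||a u v _ Pu _ Pv]; first exact: PS.
  by rewrite linear0.
by rewrite linearP; apply: PD.
Qed.

Lemma proj_eq0 (F : fieldType) (V : lmodType F) (S : V -> Prop) v :
  proj S v = 0 <-> lspan S v.
Proof.
rewrite -[v in lspan S v]subr0 -proj_eqP.
by rewrite -[proj S 0]/(proj S (0 : V)) raddf0.
Qed.

Definition ideal_gen (e : ext2 (Dt G)) : Prop :=
  exists u v, J u /\ e = wedge u v.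

Local Notation mod_ideal := (proj ideal_gen).

Lemma mod_ideal_eq0 e : mod_ideal e = 0 <-> wedge_ideal (@J G) e.
Proof. exact: proj_eq0. Qed.

Lemma mod_idealD e f : mod_ideal (e + f) = mod_ideal e + mod_ideal f.
Proof. exact: raddfD. Qed.

(** The wedge product modulo the ideal depends only on classes modulo [J], by [br_to_D], so it can
    be treated as an alternating bilinear bracket on D(G). *)
Definition br (x y : D G) : quot ideal_gen :=
  mod_ideal (wedge (lift_repr x) (lift_repr y)).

Lemma wedgeDl (V : lmodType rat) (a b x : V) : wedge (a + b) x = wedge a x +
  wedge b x.
Proof. by rewrite -[a]scale1r wedge_linl !scale1r. Qed.

Lemma wedgeDr (V : lmodType rat) (a b x : V) : wedge x (a + b) = wedge x a +
  wedge x b.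
Proof. by rewrite -[a]scale1r wedge_linr !scale1r. Qed.

Lemma br_to_D a b : br (to_D G a) (to_D G b) = mod_ideal (wedge a b).
Proof.
have reprE x : exists2 j, J j & lift_repr (to_D G x) = x + j.
  exists (lift_repr (to_D G x) - x); last by rewrite addrC subrK.
  by apply/proj_eqP; rewrite lift_reprK.
have wJl j x : J j -> mod_ideal (wedge j x) = 0.
  by move=> Jj; apply: proj_gen; exists j, x.
have wJr j x : J j -> mod_ideal (wedge x j) = 0.
  move=> Jj; rewrite (brC (@wedgeDl _) (fun a b c =>
    @wedgeDr _ b c a) (@wedge_alt _ _)).
  by rewrite raddfN /= wJl ?oppr0.
have [ja Ja] := reprE a; have [jb Jb] := reprE b; rewrite /br => -> ->.
have sum4 p q t u : mod_ideal q = 0 -> mod_ideal t = 0 -> mod_ideal u = 0 ->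
    mod_ideal ((p + q) + (t + u)) = mod_ideal p.
  by move=> q0 t0 u0; rewrite !mod_idealD q0 t0 u0 !addr0.
by rewrite wedgeDl !wedgeDr; apply: sum4;
  [apply: wJr | apply: wJl | apply: wJl].
Qed.

Lemma to_D_surj (x : D G) : exists a, x = to_D G a.
Proof. by exists (lift_repr x); rewrite [RHS]lift_reprK. Qed.

Lemma brDl a b x : br (a + b) x = br a x + br b x.
Proof.
have [a' ->] := to_D_surj a; have [b' ->] := to_D_surj b.
have [x' ->] := to_D_surj x.
by rewrite -raddfD !br_to_D wedgeDl mod_idealD.
Qed.

Lemma brDr x a b : br x (a + b) = br x a + br x b.
Proof.
have [a' ->] := to_D_surj a; have [b' ->] := to_D_surj b.
have [x' ->] := to_D_surj x.
by rewrite -raddfD !br_to_D wedgeDr mod_idealD.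
Qed.

Lemma br_alt x : br x x = 0.
Proof. by have [a ->] := to_D_surj x; rewrite br_to_D wedge_alt raddf0. Qed.

Let c (s : word G) : D G := to_D G (to_Dt G (C s)).

Lemma to_Dt_rel x : Dt_rel x -> to_D G (to_Dt G x) = 0.
Proof. by move=> Rx; rewrite [to_Dt G x]proj_gen // raddf0. Qed.

Lemma c_short s : (size s < 2)%N -> c s = 0.
Proof. by move=> s2; rewrite /c [C s]proj_gen ?raddf0 //; apply: cyc_short. Qed.

Lemma c_rot s : c (rot 1 s) = c s.
Proof. by rewrite /c C_rot1. Qed.

Lemma c_scale a s : (2 < size s)%N -> c (map (lscale a) s) = c s.
Proof.
move=> s2; have := to_Dt_rel (Dt_scale a s2).
by rewrite !raddfB => /subr0_eq/esym.
Qed.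

Lemma c_scale2 a (x z : letter G) : ~ (x = None /\ z = None) ->
  c [:: lscale a x; lscale a z] = c [:: None; Some a] + c [:: x; z].
Proof.
move=> xz; have := to_Dt_rel (Dt_scale1 a xz).
by rewrite !raddfB => /subr0_eq E; rewrite [LHS]E !raddfD.
Qed.

(** All terms of the first shuffle of zeros coincide. Their number is not 0, as the identity
    permutation is among them, and the coefficients are rational. *)
Lemma c_shuffle_zeros x n : c (x :: zeros n.+2) = 0.
Proof.
have := to_Dt_rel (@Dt_shuffle G 1 n.+1 x (fun=> None) isT isT).
rewrite /first_shuffle (eq_bigr (fun=> C (x :: zeros n.+2))) => [|sigma _];
  last first.
  congr (C (_ :: _)); apply: (@eq_from_nth _ None);
    rewrite size_map size_enum_ord.
    by rewrite size_nseq.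
  by move=> i lt_i; rewrite nth_nseq (nth_map ord0) ?size_enum_ord ?if_same.
rewrite sumr_const !raddfMn -/(c _) -scaler_nat => /eqP.
rewrite scaler_eq0 Num.Theory.pnatr_eq0 => /orP[/eqP/card0_eq/(_ 1%g)|/eqP //].
rewrite inE => /negP[]; apply/forallP => i; apply/forallP => j.
by apply/implyP => /andP[ij _]; rewrite !perm1.
Qed.

Lemma c_zeros n : c (zeros n) = 0.
Proof.
case: n => [|[|[|n]]]; try exact: c_short; last exact: c_shuffle_zeros.
exact/to_Dt_rel/Dt_zero.
Qed.

Lemma c_one_zeros n : c (Some 0 :: zeros n) = 0.
Proof.
case: n => [|[|n]]; first exact: c_short; last exact: c_shuffle_zeros.
(* Scaling by the unit gives c(0,1) = c(0,1) + c(0,1). *)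
rewrite -c_rot /=; apply: (addIr (c [:: None; Some 0])).
by rewrite -(@c_scale2 0 None (Some 0)) /= ?addr0 ?add0r //; case.
Qed.

Lemma c_doubly_shuffling : doubly_shuffling (cyclic_value c).
Proof.
have K_nil m : cyclic_value c m [::] = 0 by apply: c_one_zeros.
move=> u v m; case: u => [|y u].
  by rewrite stuffle_nill K_nil add0r /weight big_nil addn0.
case: v => [|z v]; first by rewrite stuffle_nilr K_nil addr0 /weight big_nil
  addn0.
move: (y :: u) (z :: v) (isT : (0 < size (y :: u))%N) (isT : (0 < size (z ::
  v))%N).
move=> {y z u v} u v u0 v0.
pose all := (- (total u + total v), m) :: u ++ v.
(* The letter with index 0 in [all] is chosen to make the product of all the letters trivial. *)
pose w (i : 'I_(size u + size v).+1) : G := (nth (0, 0%N) all i).1.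
pose n (i : 'I_(size u + size v).+1) : nat := (nth (0, 0%N) all i).2.
have wnE i : (w i, n i) = nth (0, 0%N) all i by rewrite /w /n
  -surjective_pairing.
have E1 : [seq (w i, n i) | i <- enum (block1 (size u) (size v))] = u.
  exact: letters_block1 wnE.
have E2 : [seq (w i, n i) | i <- enum (block2 (size u) (size v))] = v.
  exact: letters_block2 wnE.
have w0 : \sum_i w i = 0.
  rewrite sum_blocks -[X in _ + (X + _)]big_enum -[X in _ + (_ + X)]big_enum /=.
  rewrite -(big_map (fun i => (w i, n i)) xpredT (fun y : Y => y.1)) E1.
  rewrite -(big_map (fun i => (w i, n i)) xpredT (fun y : Y => y.1)) E2.
  by rewrite /w /= addNr.
pose q : {linear cyc G -> D G} := to_D G \o to_Dt G.
have q_sc a (x : word G) : (2 < size x)%N -> q (C (map (lscale a) x)) = q (C x).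
  exact: c_scale.
have := q_second_shuffle q_sc n u0 v0 w0; rewrite E1 E2.
have -> : q (second_shuffle w n) = 0.
  rewrite [LHS]proj_gen //; exists (second_shuffle w n) => //.
  by exists (size u), (size v), w, n.
move/esym/eqP; rewrite -addrA -opprD subr_eq0 => /eqP.
by rewrite /n.
Qed.

Definition reduce : {linear ext2 (cyc G) -> quot ideal_gen} :=
  mod_ideal \o ext2_map (to_Dt G).

Definition reduced_delta : {linear cyc G -> quot ideal_gen} :=
  reduce \o delta G.

Lemma reduce_sum (I : Type) (r : seq I) (P : pred I) (h : I -> ext2 (cyc G)) :
  reduce (\sum_(i <- r | P i) h i) = \sum_(i <- r | P i) reduce (h i).
Proof. exact: (linear_sum reduce). Qed.

Lemma reduce_wedge a b : reduce (wedge (C a) (C b)) = br (c a) (c b).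
Proof.
rewrite -[LHS]/(mod_ideal (ext2_map (to_Dt G) (wedge (C a) (C b)))).
by rewrite ext2_map_wedge -br_to_D.
Qed.

Lemma reduced_delta_C s : reduced_delta (C s) = necklace_cobracket br c s.
Proof.
rewrite necklace_cobracketE.
rewrite -[LHS]/(reduce (delta G (C s))) delta_C /delta_word reduce_sum.
apply: eq_bigr => k _; rewrite /cuts reduce_sum.
under eq_bigr => i _ do rewrite reduce_wedge.
case: (rot k s) => [|z w]; first by rewrite big_geq.
rewrite cut_sum -(big_mkord xpredT (fun i =>
  br (c (z :: take i w)) (c (z :: drop i w)))).
(* The two outermost cuts, absent from [cuts], each contain a word of length one. *)
have br0 a b : (size a < 2)%N || (size b < 2)%N -> br (c a) (c b) = 0.
  by case/orP => /c_short ->; rewrite ?(br0l brDl) ?(br0r brDr).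
rewrite big_nat_recr //= br0 ?drop_size ?orbT // addr0.
case: w => [|t w]; first by rewrite !big_geq.
by rewrite [RHS]big_nat_recl //= br0 ?take0 // add0r big_add1.
Qed.

(** Modulo the ideal, the coproduct is the necklace cobracket, whose cyclic values satisfy the
    relations again; [q_second_shuffle] then shows that it kills second shuffles. *)
Lemma delta_second_shuffle z : lspan (@is_second_shuffle G) z ->
  wedge_ideal (@J G) (ext2_map (to_Dt G) (delta G z)).
Proof.
move=> Sz; apply/mod_ideal_eq0.
apply: (lspan_linear (q := reduced_delta) (P := fun e => e = 0)) Sz => //.
  by move=> a x y -> ->; rewrite scaler0 addr0.
move=> _ [r [s [w [n [r0 s0 w0 ->]]]]].
rewrite (q_second_shuffle _ n r0 s0 w0) => [|a x x2].
  rewrite (_ : (fun x => _) = necklace_cobracket br c).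
    rewrite (necklace_cobracket_doubly_shuffling brDl brDr br_alt c_short c_rot
      c_scale c_scale2 c_zeros c_one_zeros c_doubly_shuffling).
    by rewrite -addrA -opprD subrr.
  by apply/funext => x; rewrite reduced_delta_C.
rewrite !reduced_delta_C.
by apply: (necklace_cobracket_scale brDl brDr br_alt c_short c_rot c_scale
  c_scale2);
  apply: ltnW.
Qed.

End Coideal.

Theorem theorem5 (G : zmodType) :
  (forall z : cyc G, lspan (@is_second_shuffle G) z ->
     wedge_ideal (@J G) (ext2_map (to_Dt G) (delta G z)))
  /\
  (forall d : {linear Dt G -> ext2 (Dt G)}, Dt_coproduct d ->
     (forall j, J j -> wedge_ideal (@J G) (d j))
     /\
     exists dD : {linear D G -> ext2 (D G)},
       (forall x, dD (to_D G x) = ext2_map (to_D G) (d x))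
       /\ forall dD' : {linear D G -> ext2 (D G)},
            (forall x, dD' (to_D G x) = ext2_map (to_D G) (d x)) -> dD' =1 dD).
Proof.
split; first exact: delta_second_shuffle.
move=> d dE.
have dJ j : J j -> wedge_ideal (@J G) (d j).
  apply: (lspan_linear (q := d)).
  - exact: span_zero.
  - by move=> a x y; apply: span_lin.
  - move=> _ [z Sz ->]; rewrite dE; apply: delta_second_shuffle.
    exact: span_gen.
split=> //.
(* The ideal dies in the exterior square of D(G), so the composite [f] below kills second shuffles
   and factors through the quotient. Uniqueness holds because the projection is onto. *)
have ideal0 e : wedge_ideal (@J G) e -> ext2_map (to_D G) e = 0.
  apply: (lspan_linear (q := ext2_map (to_D G)) (P := fun e => e = 0)) => //.
    by move=> a x y -> ->; rewrite scaler0 addr0.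
  move=> _ [u [v [Ju ->]]]; rewrite ext2_map_wedge.
  have -> : to_D G u = 0 by apply/proj_eq0.
  by apply: (addrI (wedge 0 (to_D G v))); rewrite -wedgeDl !addr0.
pose f : {linear Dt G -> ext2 (D G)} := ext2_map (to_D G) \o d.
have f0 u : second_shuffle_Dt u -> f u = 0.
  by move=> Su; apply: ideal0; apply: dJ; apply: span_gen.
exists (quot_lift f0); split=> [x|dD' dDE q]; first exact: (quot_lift_proj f0).
by rewrite -[q]lift_reprK [LHS]dDE; apply/esym/(quot_lift_proj f0).
Qed.
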